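(* Let $\lambda$ be a partition of length $<n$, let $f\in\mathbb{S}_\lambda V$, and let $p_1,\dots,p_r\in\mathbb{S}_\lambda V$ be elements of $\lambda$-rank $1$. Then the following are equivalent: (1) $f\in\langle p_1,\dots,p_r\rangle$; (2) $I(p_1,\dots,p_r):=\bigcap_{i=1}^rI(p_i)\subset f^\perp$.
   Context: $V$ is an $n$-dimensional vector space over an algebraically closed field of characteristic $0$. For a partition $\lambda$ of length $<n$ with conjugate $\lambda'$, the Schur module $\mathbb{S}_\lambda V\subset\bigotimes_j\bigwedge^{\lambda'_j}V$ is the image of the Young symmetrizer (row symmetrization followed by column antisymmetrization) for the tableau filled column by column, top to bottom; similarly for $V^*$ and skew shapes $\mu\subset\lambda$, giving $\mathbb{S}_{\lambda/\mu}V$. $\mathbb{S}^\bullet V^*:=\bigoplus_\mu\mathbb{S}_\mu V^*$. Schur apolarity $\varphi:\mathbb{S}_\lambda V\otimes\mathbb{S}_\mu V^*\to\mathbb{S}_{\lambda/\mu}V$ is zero if $\mu\not\subset\lambda$ and otherwise the restriction of the tensor product over columns of the contractions $(v_1\wedge\dots\wedge v_k)\otimes(\alpha_1\wedge\dots\wedge\alpha_h)\mapsto\sum_{|R|=h}\operatorname{sign}(R)\det(\alpha_i(v_j))_{j\in R}v_{\overline R}$. Catalecticant $\mathcal{C}^{\lambda,\mu}_f(g)=\varphi(f\otimes g)$; apolar set $f^\perp=\bigoplus_\mu\ker\mathcal{C}^{\lambda,\mu}_f$. Multiplication maps $\mathcal{M}^{\alpha,\beta}_\gamma$ ($N^{\alpha,\beta}_\gamma\ne0$)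 are the $SL(V)$-equivariant linear maps $\mathbb{S}_\alpha V^*\otimes\mathbb{S}_\beta V^*\to\mathbb{S}_\gamma V^*$ (the paper uses a basis indexed by Littlewood–Richardson tableaux). $\lambda$-rank 1: if $\lambda$ has $d_k$ columns of length $h_k$, then $d_{k-1}$ of length $h_{k-1}$, ..., $d_1$ of length $h_1$ ($h_1<\dots<h_k$, $d_i\ge1$), an element of $\lambda$-rank 1 is $p=(v_1\wedge\dots\wedge v_{h_k})^{\otimes d_k}\otimes\dots\otimes(v_1\wedge\dots\wedge v_{h_1})^{\otimes d_1}$ with $v_1,\dots,v_{h_k}$ linearly independent (these span the affine cone over the minimal $SL(V)$-orbit, the flag variety $\mathbb{F}(h_1,\dots,h_k;V)$ embedded by $\mathcal{O}(d_1,\dots,d_k)$); set $W_i=\langle v_1,\dots,v_{h_i}\rangle$. The ideal $I(p)$ is the smallest graded subspace of $\mathbb{S}^\bullet V^*$ containing $\operatorname{Sym}^{1+d_k+\dots+d_{i+1}}W_i^\perp\subset\operatorname{Sym}^mV^*=\mathbb{S}_{(m)}V^*$ for $i=1,\dots,k$ and closed under all multiplication maps applied to $g\otimes h$ with $g\in I(p)$, $h\in\mathbb{S}^\bullet V^*$ homogeneous. *)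

(* Defs.v *)
(* Coordinates: V = F^n with its standard basis,
   Vdual = F^n with the dual basis (alpha(v) = \sum_k alpha_k v_k).
   A tensor of degree d (in V^{\otimes d} or Vdual-tensor) is the
   function of its coordinates: {ffun {ffun 'I_d -> 'I_n} -> F^o}. *)
From mathcomp Require Import all_boot all_order all_algebra all_fingroup.
Unset Printing Implicit Defensive.
Import GRing.Theory.
Local Open Scope ring_scope.

Section Schur.
Context {F : fieldType} {n : nat}.

Definition tensor (d : nat) : Type := {ffun {ffun 'I_d -> 'I_n} -> F^o}.

Definition is_part (l : seq nat) : bool :=
  sorted geq l && all (fun x => 0 < x)%N l.
(* partitions of length < n : the index set of S^\bullet Vdual *)
Definition validp (mu : seq nat) : bool := is_part mu && (size mu < n)%N.
Definition conj (lam : seq nat) : seq nat :=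
  [seq count (fun x => j < x)%N lam | j <- iota 0 (head 0%N lam)].
Definition subpart (mu lam : seq nat) : Prop :=
  (size mu <= size lam)%N /\ forall i, (nth 0%N mu i <= nth 0%N lam i)%N.

(* ---------- the tableau filled column by column, top to bottom ---------- *)
Definition offset (lam : seq nat) (c : nat) : nat := sumn (take c (conj lam)).
Definition colof (lam : seq nat) (p : nat) : nat :=
  find (fun c => p < offset lam c.+1)%N (iota 0 (size (conj lam))).
Definition rowof (lam : seq nat) (p : nat) : nat := (p - offset lam (colof lam p))%N.

Definition permt d (s : 'S_d) (T : tensor d) : tensor d :=
  [ffun i : {ffun 'I_d -> 'I_n} => T [ffun k => i (s k)]].

Definition rowstab (lam : seq nat) (s : 'S_(sumn lam)) : bool :=
  [forall p, rowof lam (s p) == rowof lam p].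
Definition colstab (lam : seq nat) (s : 'S_(sumn lam)) : bool :=
  [forall p, colof lam (s p) == colof lam p].

Definition symR (lam : seq nat) (T : tensor (sumn lam)) : tensor (sumn lam) :=
  \sum_(s | rowstab lam s) permt (sumn lam) s T.
Definition antiC (lam : seq nat) (T : tensor (sumn lam)) : tensor (sumn lam) :=
  \sum_(s | colstab lam s) (-1) ^+ s *: permt (sumn lam) s T.

(* Schur module (of V, or of Vdual : same coordinate description):
   image of the Young symmetrizer, row symmetrization followed by
   column antisymmetrization *)
Definition SchurMod (lam : seq nat) (T : tensor (sumn lam)) : Prop :=
  exists U, T = antiC lam (symR lam U).

(* Given a full index assignment i of the lam-positions and an assignment j
   of the mu-positions, the assignment in which the top mu'_c boxes of each
   column c of lam are filled with the indices of column c of mu. *)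
Definition merge (lam mu : seq nat) (i : {ffun 'I_(sumn lam) -> 'I_n})
  (j : {ffun 'I_(sumn mu) -> 'I_n}) : {ffun 'I_(sumn lam) -> 'I_n} :=
  [ffun p : 'I_(sumn lam) =>
     let c := colof lam p in let r := rowof lam p in
     if (r < nth 0%N (conj mu) c)%N then
       oapp j (i p) (insub (offset mu c + r)%N : option 'I_(sumn mu))
     else i p].

(* phi(f (x) g) for mu \subset lam: contraction, column by column, of the
   exterior powers; the value at i depends only on the non-contracted
   positions (the remaining boxes of lam/mu).  The factor
   1 / prod_c (mu'_c)! matches the paper's formula with the convention
   v_1/\../\v_k = sum_s sgn(s) v_s1 (x) .. (x) v_sk. *)
Definition apolar (lam mu : seq nat) (f : tensor (sumn lam)) (g : tensor (sumn mu))
  : tensor (sumn lam) :=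
  [ffun i => ((\prod_(c <- conj mu) (c`!)%:R : F)^-1 *
              \sum_(j : {ffun 'I_(sumn mu) -> 'I_n}) g j * f (merge lam mu i j)
              : F^o)].

(* g belongs to the degree-mu part of f^perp (f in S_lam V, g in S_mu Vdual):
   C^{lam,mu}_f(g) = 0, where phi = 0 when mu is not contained in lam. *)
Definition in_perp (lam : seq nat) (f : tensor (sumn lam)) (mu : seq nat)
  (g : tensor (sumn mu)) : Prop :=
  SchurMod mu g /\ (subpart mu lam -> apolar lam mu f g = 0).

Definition vcoord {h} (v : 'M[F]_(h, n)) (r : nat) (k : 'I_n) : F :=
  oapp (fun r' : 'I_h => v r' k) 0 (insub r).

(* (v_1/\../\v_{lam'_1}) (x) (v_1/\../\v_{lam'_2}) (x) ... , column by column
   (columns of lam from the left have nonincreasing lengths), in coordinates: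
   the coordinate of v_1/\../\v_h at (i_1..i_h) is det(v_r(i_s)). *)
Definition rank1 (lam : seq nat) (v : 'M[F]_(size lam, n)) : tensor (sumn lam) :=
  [ffun i : {ffun 'I_(sumn lam) -> 'I_n} =>
    (\prod_(c < size (conj lam))
       \det (\matrix_(r < nth 0%N (conj lam) c, s < nth 0%N (conj lam) c)
               oapp (fun q => vcoord v r (i q)) 0
                    (insub (offset lam c + s)%N : option 'I_(sumn lam))) : F^o)].

Definition lam_rank1 (lam : seq nat) (p : tensor (sumn lam)) : Prop :=
  exists v : 'M[F]_(size lam, n), row_free v /\ p = rank1 lam v.

Definition in_Wperp (lam : seq nat) (v : 'M[F]_(size lam, n)) (h : nat)
  (alpha : 'I_n -> F) : Prop :=
  forall r, (r < h)%N -> \sum_k alpha k * vcoord v r k = 0.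

(* action of g in GL(V) on Vdual-tensor: contragredient (inverse transpose) *)
Definition actD (g : 'M[F]_n) {d} (A : tensor d) : tensor d :=
  [ffun i : {ffun 'I_d -> 'I_n} =>
     (\sum_(j : {ffun 'I_d -> 'I_n}) (\prod_k invmx g (j k) (i k)) * A j : F^o)].

(* Littlewood-Richardson tableaux of shape c/a and content b:
   N^{a,b}_c <> 0 iff one exists.  T r x = entry in row r, column x. *)
Definition LR_tableau (a b c : seq nat) (T : nat -> nat -> nat) : Prop :=
  let inshape r x := (nth 0%N a r <= x < nth 0%N c r)%N in
  let w := flatten [seq [seq T r x | x <- rev (iota (nth 0%N a r) (nth 0%N c r - nth 0%N a r))]
                   | r <- iota 0 (size c)] in
  [/\ forall r x, inshape r x -> (0 < T r x)%N,
      forall r x, inshape r x -> inshape r x.+1 -> (T r x <= T r x.+1)%N,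
      forall r x, inshape r x -> inshape r.+1 x -> (T r x < T r.+1 x)%N,
      forall i, count_mem i.+1 w = nth 0%N b i &
      forall k i, (count_mem i.+2 (take k w) <= count_mem i.+1 (take k w))%N].

Definition LR_nonzero (a b c : seq nat) : Prop :=
  subpart a c /\ exists T, LR_tableau a b c T.

(* an SL(V)-equivariant linear map S_a Vdual (x) S_b Vdual -> S_c Vdual,
   represented as the corresponding bilinear map on S_a Vdual x S_b Vdual *)
Definition mult_map (a b c : seq nat)
  (M : tensor (sumn a) -> tensor (sumn b) -> tensor (sumn c)) : Prop :=
  [/\ forall x y, SchurMod a x -> SchurMod b y -> SchurMod c (M x y),
      forall (t : F) x x' y, SchurMod a x -> SchurMod a x' -> SchurMod b y ->
        M (t *: x + x') y = t *: M x y + M x' y,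
      forall (t : F) x y y', SchurMod a x -> SchurMod b y -> SchurMod b y' ->
        M x (t *: y + y') = t *: M x y + M x y' &
      forall g : 'M[F]_n, \det g = 1 -> forall x y, SchurMod a x -> SchurMod b y ->
        M (actD g x) (actD g y) = actD g (M x y)].

(* a graded subspace of S^\bullet Vdual = (+)_{mu valid} S_mu Vdual *)
Definition graded_subspace (J : forall mu : seq nat, tensor (sumn mu) -> Prop) : Prop :=
  forall mu, validp mu ->
    [/\ J mu 0,
        forall (t : F) x y, J mu x -> J mu y -> J mu (t *: x + y) &
        forall x, J mu x -> SchurMod mu x].

(* J contains Sym^{1 + d_k + .. + d_{i+1}} W_i^perp in Sym^m Vdual = S_(m) Vdual
   for every i; h_i runs over the column lengths of lam and
   d_k + .. + d_{i+1} = number of columns of length > h_i.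
   Sym^m W^perp is spanned by the symmetrizations of a_1 (x) .. (x) a_m,
   a_k in W^perp (J being a subspace, containing these suffices). *)
Definition contains_gens (lam : seq nat) (v : 'M[F]_(size lam, n))
  (J : forall mu : seq nat, tensor (sumn mu) -> Prop) : Prop :=
  forall c, (c < size (conj lam))%N ->
    let h := nth 0%N (conj lam) c in
    let m := (count (fun x => h < x)%N (conj lam)).+1 in
    forall alpha : 'I_(sumn [:: m]) -> 'I_n -> F,
      (forall k, in_Wperp lam v h (alpha k)) ->
      J [:: m] (symR [:: m] [ffun i : {ffun 'I_(sumn [:: m]) -> 'I_n} =>
                               (\prod_k alpha k (i k) : F^o)]).

Definition mult_closed (J : forall mu : seq nat, tensor (sumn mu) -> Prop) : Prop :=
  forall a b c, validp a -> validp b -> validp c -> LR_nonzero a b c ->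
    forall M, mult_map a b c M ->
      forall x y, J a x -> SchurMod b y -> J c (M x y).

(* I(p): the smallest such graded subspace (intersection of all of them).
   The generators are given in terms of any presentation p = rank1 lam v
   (the flag W_1 < ... < W_k is determined by p). *)
Definition Ideal (lam : seq nat) (p : tensor (sumn lam)) (mu : seq nat)
  (g : tensor (sumn mu)) : Prop :=
  forall J : forall nu : seq nat, tensor (sumn nu) -> Prop,
    graded_subspace J ->
    (forall v, row_free v -> p = rank1 lam v -> contains_gens lam v J) ->
    mult_closed J -> J mu g.

End Schur.

(* Main.v *)
From HB Require Import structures.
Require Import Defs.
From mathcomp Require Import all_boot all_order all_algebra all_fingroup.
From mathcomp Require Import zify.
From Stdlib Require Import Classical.
Import GRing.Theory.
Local Open Scope ring_scope.

(** [I(p)] annihilates [p]: for [p] of rank one, the family [polar p], defined by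
    testing against all tensors that scale in the same way as [p] under every
    [gam] in SL(V) scaling [p], is closed under multiplication for formal reasons
    and lies in the apolar set. It contains the generators of [I(p)]: in a basis
    adapted to the flag of [p], such a tensor is fixed by the transvections
    e_j -> e_j + e_h (h < j) and has lambda_h letters h; if it is symmetric in
    more than lambda_h slots carrying only letters >= h, it vanishes.

    [I(p)] contains all of the hyperplane of S_lambda Vdual orthogonal to [p]:
    let [u] be a functional killing the degree lambda part of [I(p)]. Multiplying
    a^m by a rank one tensor of the shape obtained from lambda by removing row
    h+1 and the last box of row h (a single Littlewood-Richardson product) shows
    that the derivative of [u] on the rank one tensors vanishes in the direction
    l_h -> l_h + t l_(h+1), as soon as l_(h+1) annihilates W_h. Hence [u] is
    constant on the unipotent orbit of the dual highest weight vector, and, after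
    subtraction of a multiple of [p], vanishes on all rank one tensors; these span
    by polarization. Finally the Young symmetrizer is a nonzero scalar on
    S_lambda, so linear duality gives the theorem. *)

Set Implicit Arguments.
Unset Strict Implicit.

(** * Tableaux *)

Section Tableau.
Local Open Scope nat_scope.
Implicit Types lam mu : seq nat.

(** The kernel of apolarity is not visibly stable under multiplication: an arbitrary equivariant map
    [M] does not commute with contraction against [p]. The tests in [polar] therefore carry spare
    slots, so that the second factor of a product can be absorbed into them. They involve
    determinant one only, because multiplication maps are only SL-equivariant; keeping the total
    number of slots equal to |lambda| makes up for the missing scalar matrices, since the scalar
    part of a torus element then acts on the test and on [p] in the same way. For the converse
    inclusion, the derivative along l_h -> l_h + t l_(h+1) is a sum over the boxes of row h. A box
    whose column continues below contributes a tensor with a repeated vector in a column, which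
    dies; each remaining box lies in a column of length exactly h and is killed by one product with
    a generator attached to W_h. The field has neither order nor topology. Positivity is replaced by
    integrality of coordinates, and density of the big cell by Gaussian elimination together with
    polynomials vanishing at all positive integers. *)

Lemma part_nth_anti lam i j :
  is_part lam -> i <= j -> nth 0 lam j <= nth 0 lam i.
Proof.
case/andP=> sl _ ij; case: (ltnP j (size lam)) => js; last by rewrite nth_default.
have tr : transitive geq by move=> a b c /= ba ac; exact: leq_trans ac ba.
have rf : reflexive geq by move=> x; exact: leqnn.
apply: (sorted_leq_nth tr rf 0 sl) => //; rewrite ?inE //.
exact: leq_ltn_trans js.
Qed.

Lemma part_nth_gt0 lam i : is_part lam -> (0 < nth 0 lam i) = (i < size lam).
Proof.
case/andP=> _ /allP pos; case: (ltnP i (size lam)) => il.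
  by rewrite pos // mem_nth.
by rewrite nth_default.
Qed.

Lemma part_behead x lam : is_part (x :: lam) -> is_part lam.
Proof. by case/andP=> /= /path_sorted sl /andP[_ al]; apply/andP. Qed.

Lemma part_le_head x lam y : is_part (x :: lam) -> y \in lam -> y <= x.
Proof.
move=> pl /(nthP 0)[i il <-].
exact: (@part_nth_anti (x :: lam) 0 i.+1).
Qed.

Lemma nth_conj lam c :
  is_part lam -> nth 0 (Defs.conj lam) c = count (fun x => c < x) lam.
Proof.
move=> pl; rewrite /Defs.conj; case: (ltnP c (head 0 lam)) => cl.
  by rewrite (nth_map 0) ?size_iota // nth_iota.
rewrite nth_default ?size_map ?size_iota //; apply/esym/eqP.
rewrite -leqn0 leqNgt -has_count; apply/hasPn=> x xl; rewrite -leqNgt.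
case: lam pl cl xl => // y l pl /= cl; rewrite inE => /predU1P[->//|xl].
exact: leq_trans (part_le_head pl xl) cl.
Qed.

(** Both sides say that the box in row [r] and column [c] belongs to the diagram; the passage
    between rows and columns rests on this equivalence. *)
Lemma ltn_conj lam r c :
  is_part lam -> (r < nth 0 (Defs.conj lam) c) = (c < nth 0 lam r).
Proof.
move=> pl; rewrite nth_conj //; elim: lam r pl => [|x l IH] r pl /=.
  by rewrite nth_nil.
have pl' := part_behead pl.
case: (ltnP c x) => cx; first by case: r => [|r] //=; rewrite ltnS IH.
have -> : count (fun y => c < y) l = 0.
  apply/eqP; rewrite -leqn0 leqNgt -has_count; apply/hasPn=> y yl.
  by rewrite -leqNgt (leq_trans (part_le_head pl yl)).
rewrite addn0; case: r => [|r]; first by rewrite [in RHS]ltnNge cx.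
rewrite [LHS]ltn0; apply/esym/negbTE; rewrite -leqNgt.
exact: leq_trans (@part_nth_anti (x :: l) 0 r.+1 pl _) cx.
Qed.

Lemma size_conj lam : size (Defs.conj lam) = head 0 lam.
Proof. by rewrite size_map size_iota. Qed.

Lemma nth_conj_le lam c : is_part lam -> nth 0 (Defs.conj lam) c <= size lam.
Proof. by move=> pl; rewrite nth_conj // count_size. Qed.

Lemma sum_ltn_bound x h : x <= h -> \sum_(j < h) (j < x) = x.
Proof.
move=> xh; rewrite -(big_mkord xpredT (fun j => (j < x : nat))) (big_cat_nat (leq0n x) xh) /=.
rewrite (eq_big_nat _ _ (F2 := fun=> 1)) => [|j /andP[_ ->]//].
rewrite [X in _ + X]big_nat [X in _ + X]big1 => [|j /andP[xj _]]; last by rewrite ltnNge xj.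
by rewrite sum_nat_const_nat addn0 muln1 subn0.
Qed.

Lemma sumn_conj lam : is_part lam -> sumn (Defs.conj lam) = sumn lam.
Proof.
move=> pl; rewrite !sumnE big_map -{1}(subn0 (head 0 lam)) big_mkord.
rewrite (eq_bigr (fun j : 'I__ => \sum_(x <- lam) (j < x))); last first.
  by move=> j _; rewrite -sum1_count big_mkcond; apply: eq_bigr => x _; case: ifP.
rewrite exchange_big /= !big_seq; apply: eq_bigr => x xl.
apply: sum_ltn_bound; case: lam pl xl => // y l pl /=.
by rewrite inE => /predU1P[->//|xl]; exact: part_le_head pl xl.
Qed.

Lemma offsetS lam c : offset lam c.+1 = offset lam c + nth 0 (Defs.conj lam) c.
Proof.
rewrite /offset; case: (ltnP c (size (Defs.conj lam))) => cs.
  by rewrite (take_nth 0) // sumn_rcons.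
by rewrite nth_default // !take_oversize ?addn0 // leqW.
Qed.

Lemma offset_homo lam c c' : c <= c' -> offset lam c <= offset lam c'.
Proof.
move=> cc; elim: c' cc => [|k IH]; first by rewrite leqn0 => /eqP->.
rewrite leq_eqVlt => /predU1P[->//|/IH h].
by rewrite offsetS (leq_trans h) ?leq_addr.
Qed.

Lemma offset_uniq lam p c c' : offset lam c <= p < offset lam c.+1 ->
  offset lam c' <= p < offset lam c'.+1 -> c = c'.
Proof.
move=> /andP[h1 h2] /andP[h3 h4]; case: (ltngtP c c') => // cc.
  by have := leq_trans (offset_homo lam cc) h3; rewrite leqNgt h2.
by have := leq_trans (offset_homo lam cc) h1; rewrite leqNgt h4.
Qed.

Lemma colof_bounds lam p : is_part lam -> p < sumn lam ->
  [/\ colof lam p < size (Defs.conj lam), offset lam (colof lam p) <= p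
    & p < offset lam (colof lam p).+1].
Proof.
move=> pl ps; have hs : has (fun c => p < offset lam c.+1) (iota 0 (size (Defs.conj lam))).
  apply/hasP; exists (size (Defs.conj lam)).-1.
    rewrite mem_iota /= add0n ltn_predL lt0n; apply/eqP=> s0.
    by move: ps; rewrite -(@sumn_conj lam) // (size0nil s0).
  rewrite /offset take_oversize ?sumn_conj //; exact: leqSpred.
have fs := hs; rewrite has_find size_iota in fs.
split=> //; last by have := nth_find 0 hs; rewrite nth_iota.
case E : (colof lam p) => [|c]; first by rewrite /offset take0.
have cf : c < find (fun c => p < offset lam c.+1) (iota 0 (size (Defs.conj lam))).
  by rewrite -[find _ _]/(colof lam p) E.
have := before_find 0 cf; rewrite nth_iota ?(ltn_trans cf) // add0n.
by move/negbT; rewrite -leqNgt.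
Qed.

Lemma rowof_bound lam p : is_part lam -> p < sumn lam ->
  rowof lam p < nth 0 (Defs.conj lam) (colof lam p).
Proof.
by move=> pl ps; case: (colof_bounds pl ps) => _ h1; rewrite offsetS /rowof ltn_subLR.
Qed.

Lemma offset_colof lam p : is_part lam -> p < sumn lam ->
  offset lam (colof lam p) + rowof lam p = p.
Proof. by move=> pl ps; case: (colof_bounds pl ps) => _ h1 _; rewrite subnKC. Qed.

Lemma colof_lt lam p : is_part lam -> p < sumn lam ->
  colof lam p < nth 0 lam (rowof lam p).
Proof. by move=> pl ps; rewrite -ltn_conj // rowof_bound. Qed.

Lemma box_lt lam c r : is_part lam -> r < nth 0 (Defs.conj lam) c ->
  offset lam c + r < sumn lam.
Proof.
move=> pl rc; have cs : c < size (Defs.conj lam).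
  by rewrite ltnNge; apply/negP=> sc; rewrite nth_default in rc.
rewrite -(@sumn_conj lam) //.
apply: (@leq_trans (offset lam c.+1)); first by rewrite offsetS ltn_add2l.
by rewrite -[X in _ <= sumn X](take_size (Defs.conj lam)); exact: offset_homo.
Qed.

Lemma colof_box lam c r : is_part lam -> r < nth 0 (Defs.conj lam) c ->
  colof lam (offset lam c + r) = c.
Proof.
move=> pl rc; case: (colof_bounds pl (box_lt pl rc)) => _ h1 h2.
apply: (@offset_uniq lam (offset lam c + r)); first by rewrite h1.
by rewrite leq_addr offsetS ltn_add2l.
Qed.

Lemma rowof_box lam c r : is_part lam -> r < nth 0 (Defs.conj lam) c ->
  rowof lam (offset lam c + r) = r.
Proof. by move=> pl rc; rewrite /rowof colof_box // addKn. Qed.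

Lemma box_exists lam r c : is_part lam -> c < nth 0 lam r ->
  exists k : 'I_(sumn lam), rowof lam k = r /\ colof lam k = c.
Proof.
move=> pl; rewrite -ltn_conj // => rc.
by exists (Ordinal (box_lt pl rc)); rewrite /= rowof_box ?colof_box.
Qed.

Lemma box_inj lam (k k' : 'I_(sumn lam)) : is_part lam ->
  rowof lam k = rowof lam k' -> colof lam k = colof lam k' -> k = k'.
Proof.
move=> pl er ec; apply: val_inj => /=.
by rewrite -(@offset_colof lam k) // -(@offset_colof lam k') // er ec.
Qed.

Lemma rowof_lt_size lam (k : 'I_(sumn lam)) : is_part lam -> rowof lam k < size lam.
Proof.
by move=> pl; rewrite -part_nth_gt0 //; apply: leq_trans (colof_lt pl (ltn_ord k)).
Qed.

Lemma card_row lam r : is_part lam ->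
  #|[set k : 'I_(sumn lam) | rowof lam k == r]| = nth 0 lam r.
Proof.
move=> pl; have /fin_all_exists[f fP] (c : 'I_(nth 0 lam r)) := box_exists pl (ltn_ord c).
have fi : injective f by move=> c c' e; apply: val_inj; rewrite /= -(fP c).2 -(fP c').2 e.
rewrite -[RHS]card_ord -(card_imset _ fi); apply: eq_card => k; rewrite inE.
apply/eqP/imsetP => [e|[c _ ->]]; last exact: (fP c).1.
have cl : colof lam k < nth 0 lam r by rewrite -e colof_lt.
exists (Ordinal cl) => //; apply: box_inj => //; first by rewrite (fP _).1.
by rewrite (fP _).2.
Qed.

Lemma card_col lam c : is_part lam ->
  #|[set k : 'I_(sumn lam) | colof lam k == c]| = nth 0 (Defs.conj lam) c.
Proof.
move=> pl; have ex (r : 'I_(nth 0 (Defs.conj lam) c)) :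
    exists k : 'I_(sumn lam), rowof lam k = r /\ colof lam k = c.
  by apply: box_exists => //; rewrite -ltn_conj.
have /fin_all_exists[f fP] := ex.
have fi : injective f by move=> r r' e; apply: val_inj; rewrite /= -(fP r).1 -(fP r').1 e.
rewrite -[RHS]card_ord -(card_imset _ fi); apply: eq_card => k; rewrite inE.
apply/eqP/imsetP => [e|[r _ ->]]; last exact: (fP r).2.
have rl : rowof lam k < nth 0 (Defs.conj lam) c by rewrite -e rowof_bound.
exists (Ordinal rl) => //; apply: box_inj => //; first by rewrite (fP _).1.
by rewrite (fP _).2.
Qed.

(** Identifies the degree of the generators: with rows numbered from 0, those attached to W_h live
    in degree [(nth 0 lam h).+1]. *)
Lemma count_conj lam h : is_part lam ->
  count (fun x => h < x) (Defs.conj lam) = nth 0 lam h.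
Proof.
move=> pl; rewrite -sum1_count big_mkcond (big_nth 0) big_mkord size_conj.
rewrite (eq_bigr (fun c : 'I__ => (c < nth 0 lam h : nat))); last first.
  by move=> c _; rewrite ltn_conj //; case: ifP.
by apply: sum_ltn_bound; rewrite -nth0; exact: part_nth_anti.
Qed.

End Tableau.

(** * Tensors *)

Section Tensors.
Context {F : fieldType} {n : nat}.
Implicit Types (K : finType) (N M : 'M[F]_n).
Local Notation gtensor K := {ffun {ffun K%type -> 'I_n} -> F^o}.

(** Row vector convention: each factor y of a decomposable tensor becomes yN, so this is a right
    action ([tactM]). [N] may be singular. *)
Definition tact (K : finType) (N : 'M[F]_n) (T : gtensor K) : gtensor K :=
  [ffun i : {ffun K -> 'I_n} =>
     (\sum_(j : {ffun K -> 'I_n}) (\prod_k N (j k) (i k)) * T j : F^o)].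
Definition dec (K : finType) (y : K -> 'I_n -> F) : gtensor K :=
  [ffun i : {ffun K -> 'I_n} => (\prod_k y k (i k) : F^o)].
Definition dot (K : finType) (u T : gtensor K) : F^o := \sum_i u i * T i.
Definition reindex_tensor (A B : finType) (f : A -> B) (T : gtensor A) : gtensor B :=
  [ffun w : {ffun B -> 'I_n} => T [ffun a => w (f a)]].
Definition word (K : finType) (w : {ffun K -> 'I_n}) : gtensor K :=
  dec (fun k b => (b == w k)%:R).

Fact tact_is_linear K N : linear (@tact K N).
Proof.
move=> t x y; apply/ffunP=> i; rewrite !ffunE scaler_sumr -big_split /=.
by apply: eq_bigr => j _; rewrite !ffunE /GRing.scale /= mulrDr mulrCA.
Qed.
HB.instance Definition _ K N := GRing.isLinear.Build F _ _ _ (@tact K N) (@tact_is_linear K N).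

Fact dot_is_linear K u : linear (@dot K u).
Proof.
move=> t x y; rewrite scaler_sumr -big_split /=.
by apply: eq_bigr => j _; rewrite !ffunE /GRing.scale /= mulrDr mulrCA.
Qed.
HB.instance Definition _ K u := GRing.isLinear.Build F _ _ _ (@dot K u) (@dot_is_linear K u).

Fact reindex_is_linear A B f : linear (@reindex_tensor A B f).
Proof. by move=> t x y; apply/ffunP=> i; rewrite !ffunE. Qed.
HB.instance Definition _ A B f :=
  GRing.isLinear.Build F _ _ _ (@reindex_tensor A B f) (@reindex_is_linear A B f).

Lemma dotC K (u T : gtensor K) : dot u T = dot T u.
Proof. by apply: eq_bigr => i _; rewrite mulrC. Qed.

Lemma wordE K (w i : {ffun K -> 'I_n}) : word w i = (i == w)%:R.
Proof.
rewrite ffunE; case: eqP => [->|ne]; first by rewrite big1 // => k _; rewrite eqxx.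
have /existsP[k kne] : [exists k, i k != w k].
  rewrite -[X in is_true X]negbK negb_exists; apply/negP=> /forallP h.
  by apply: ne; apply/ffunP=> k; apply/eqP; have := h k; rewrite negbK.
by rewrite (bigD1 k) //= (negbTE kne) mul0r.
Qed.

Lemma tensor_words K (T : gtensor K) : T = \sum_w T w *: word w.
Proof.
apply/ffunP=> i; rewrite sum_ffunE (bigD1 i) //= big1 ?addr0 => [|w wi].
  by rewrite ffunE wordE eqxx /GRing.scale /= mulr1.
by rewrite ffunE wordE eq_sym (negbTE wi) scaler0.
Qed.

Lemma dot_word K (T : gtensor K) w : dot T (word w) = T w.
Proof.
rewrite /dot (bigD1 w) //= big1 ?addr0 => [|i iw]; first by rewrite wordE eqxx mulr1.
by rewrite wordE (negbTE iw) mulr0.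
Qed.

Lemma dot_inj K (u v : gtensor K) : (forall T, dot u T = dot v T) -> u = v.
Proof. by move=> h; apply/ffunP=> i; rewrite -!dot_word h. Qed.

Lemma tact_dec K N (y : K -> 'I_n -> F) :
  tact N (dec y) = dec (fun k b => \sum_a y k a * N a b).
Proof.
apply/ffunP=> i; rewrite !ffunE (bigA_distr_bigA (fun k a => y k a * N a (i k))).
by apply: eq_bigr => j _; rewrite big_split /= ffunE mulrC.
Qed.

Lemma eq_dec K (y y' : K -> 'I_n -> F) : (forall k, y k =1 y' k) -> dec y = dec y'.
Proof. by move=> e; apply/ffunP=> i; rewrite !ffunE; apply: eq_bigr => k _; rewrite e. Qed.

Lemma tactM K N M (T : gtensor K) : tact N (tact M T) = tact (M *m N) T.
Proof.
rewrite [T]tensor_words !linear_sum /=; apply: eq_bigr => w _.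
rewrite !linearZ /=; congr (_ *: _); rewrite !tact_dec; apply: eq_dec => k b.
under eq_bigr do rewrite mulr_suml.
rewrite exchange_big /=; apply: eq_bigr => a _; rewrite mxE mulr_sumr.
by apply: eq_bigr => c _; rewrite mulrA.
Qed.

Lemma tact1 K (T : gtensor K) : tact 1%:M T = T.
Proof.
rewrite [T]tensor_words linear_sum /=; apply: eq_bigr => w _.
rewrite linearZ /=; congr (_ *: _); rewrite tact_dec; apply: eq_dec => k b.
rewrite (bigD1 (w k)) //= eqxx mul1r mxE eq_sym big1 ?addr0 // => a aw.
by rewrite (negbTE aw) mul0r.
Qed.

Lemma dot_tact K N (u T : gtensor K) : dot (tact N u) T = dot u (tact N^T T).
Proof.
rewrite /dot; under eq_bigr do rewrite ffunE mulr_suml.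
rewrite exchange_big /=; apply: eq_bigr => j _; rewrite ffunE mulr_sumr.
apply: eq_bigr => i _; rewrite [_ * u j]mulrC -mulrA; congr (_ * (_ * _)).
by apply: eq_bigr => k _; rewrite mxE.
Qed.

Lemma reindex_dec (A B : finType) (f : A -> B) (g : B -> A) (y : A -> 'I_n -> F) :
  cancel f g -> cancel g f -> reindex_tensor f (dec y) = dec (fun b => y (g b)).
Proof.
move=> fg gf; apply/ffunP=> i; rewrite !ffunE (reindex g) /=; last by exists f => ? _.
by apply: eq_bigr => b _; rewrite ffunE gf.
Qed.

Lemma tact_reindex (A B : finType) (f : A -> B) N (T : gtensor A) : bijective f ->
  tact N (reindex_tensor f T) = reindex_tensor f (tact N T).
Proof.
case=> g fg gf; rewrite [T]tensor_words !linear_sum /=; apply: eq_bigr => w _.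
rewrite !linearZ /=; congr (_ *: _).
by rewrite (reindex_dec _ fg gf) !tact_dec (reindex_dec _ fg gf).
Qed.

Lemma reindex_comp (A B C : finType) (f : A -> B) (g : B -> C) (T : gtensor A) :
  reindex_tensor g (reindex_tensor f T) = reindex_tensor (g \o f) T.
Proof.
by apply/ffunP=> w; rewrite !ffunE; congr (T _); apply/ffunP=> a; rewrite !ffunE.
Qed.

Lemma dot_reindex (A B : finType) (f : A -> B) (g : B -> A) (u : gtensor A) (T : gtensor B) :
  cancel f g -> cancel g f -> dot (reindex_tensor f u) T = dot u (reindex_tensor g T).
Proof.
move=> fg gf; rewrite /dot (reindex (fun w : {ffun A -> 'I_n} => [ffun b => w (g b)])) /=.
  apply: eq_bigr => w _; rewrite !ffunE; congr (u _ * _).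
  by apply/ffunP=> a; rewrite !ffunE fg.
exists (fun w : {ffun B -> 'I_n} => [ffun a => w (f a)]) => w _;
  by apply/ffunP=> a; rewrite !ffunE ?fg ?gf.
Qed.

Lemma permtE d (s : 'S_d) (T : gtensor 'I_d) : permt d s T = reindex_tensor s T.
Proof. by []. Qed.

Lemma permtM d (s t : 'S_d) (T : gtensor 'I_d) :
  permt d s (permt d t T) = permt d (t * s)%g T.
Proof.
rewrite !permtE reindex_comp; apply/ffunP=> w; rewrite !ffunE; congr (T _).
by apply/ffunP=> k; rewrite !ffunE permM.
Qed.

Lemma dot_permt d (s : 'S_d) (u T : gtensor 'I_d) :
  dot (permt d s u) T = dot u (permt d s^-1 T).
Proof. by rewrite !permtE; apply: dot_reindex; [exact: permK|exact: permKV]. Qed.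

Lemma tact_permt d (s : 'S_d) N (T : gtensor 'I_d) :
  tact N (permt d s T) = permt d s (tact N T).
Proof. by rewrite !permtE; apply: tact_reindex; exists s^-1%g; [exact: permK|exact: permKV]. Qed.

Lemma actDE (g : 'M[F]_n) d (T : tensor d) : actD g T = tact (invmx g) T.
Proof. by []. Qed.

(** * Symmetrization over the row group and antisymmetrization over the column group *)

Section Stab.
Variable lam : seq nat.
Local Notation d := (sumn lam).
Local Notation R := (@symR F n lam).
Local Notation C := (@antiC F n lam).

Fact permt_is_linear (s : 'S_d) : linear (permt d s : gtensor 'I_d -> gtensor 'I_d).
Proof. exact: reindex_is_linear. Qed.

Fact symR_is_linear : linear (R : gtensor 'I_d -> gtensor 'I_d).
Proof.
move=> t x y; rewrite /symR scaler_sumr -big_split; apply: eq_bigr => s _.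
exact: permt_is_linear.
Qed.
HB.instance Definition _ := GRing.isLinear.Build F _ _ _ (R : gtensor 'I_d -> gtensor 'I_d) symR_is_linear.

Fact antiC_is_linear : linear (C : gtensor 'I_d -> gtensor 'I_d).
Proof.
move=> t x y; rewrite /antiC scaler_sumr -big_split; apply: eq_bigr => s _ /=.
by rewrite permt_is_linear scalerDr !scalerA mulrC.
Qed.
HB.instance Definition _ := GRing.isLinear.Build F _ _ _ (C : gtensor 'I_d -> gtensor 'I_d) antiC_is_linear.

Lemma antiC_def (T : gtensor 'I_d) :
  C T = \sum_(s | colstab lam s) (-1) ^+ s *: permt d s T.
Proof. by []. Qed.
Lemma symRE (T : gtensor 'I_d) i :
  R T i = \sum_(s | rowstab lam s) T [ffun k => i (s k)].
Proof. by rewrite /symR sum_ffunE; apply: eq_bigr => s _; rewrite ffunE. Qed.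
Lemma antiCE (T : gtensor 'I_d) i :
  C T i = \sum_(s | colstab lam s) (-1) ^+ s * T [ffun k => i (s k)].
Proof. by rewrite /antiC sum_ffunE; apply: eq_bigr => s _; rewrite !ffunE. Qed.

Lemma rowstabP (s : 'S_d) : reflect (forall k, rowof lam (s k) = rowof lam k) (rowstab lam s).
Proof. by apply: (iffP forallP) => h k; apply/eqP; exact: h. Qed.
Lemma colstabP (s : 'S_d) : reflect (forall k, colof lam (s k) = colof lam k) (colstab lam s).
Proof. by apply: (iffP forallP) => h k; apply/eqP; exact: h. Qed.

Lemma rowstabM (s t : 'S_d) : rowstab lam t -> rowstab lam (t * s)%g = rowstab lam s.
Proof.
move=> /rowstabP ht; apply/rowstabP/rowstabP => h k; last by rewrite permM h ht.
by have := h (t^-1%g k); rewrite permM permKV => ->; rewrite -{2}(permKV t k) ht.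
Qed.
Lemma colstabM (s t : 'S_d) : colstab lam t -> colstab lam (t * s)%g = colstab lam s.
Proof.
move=> /colstabP ht; apply/colstabP/colstabP => h k; last by rewrite permM h ht.
by have := h (t^-1%g k); rewrite permM permKV => ->; rewrite -{2}(permKV t k) ht.
Qed.
Lemma rowstab1 : rowstab lam 1%g.
Proof. by apply/rowstabP=> k; rewrite perm1. Qed.
Lemma colstab1 : colstab lam 1%g.
Proof. by apply/colstabP=> k; rewrite perm1. Qed.
Lemma rowstabV (s : 'S_d) : rowstab lam s^-1%g = rowstab lam s.
Proof. by apply/rowstabP/rowstabP => h k; have := h (s k); have := h (s^-1%g k); rewrite ?permK ?permKV. Qed.
Lemma colstabV (s : 'S_d) : colstab lam s^-1%g = colstab lam s.
Proof. by apply/colstabP/colstabP => h k; have := h (s k); have := h (s^-1%g k); rewrite ?permK ?permKV. Qed.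

Lemma symR_permt s (T : gtensor 'I_d) : rowstab lam s -> R (permt d s T) = R T.
Proof.
move=> hs; rewrite /symR [RHS](reindex_inj (mulgI s)) /=; apply: eq_big => t.
  by rewrite rowstabM.
by move=> _; rewrite permtM.
Qed.

Lemma antiC_permt s (T : gtensor 'I_d) :
  colstab lam s -> C (permt d s T) = (-1) ^+ s *: C T.
Proof.
move=> hs; rewrite /antiC [X in _ *: X](reindex_inj (mulgI s)) /= scaler_sumr.
apply: eq_big => t; first by rewrite colstabM.
by move=> _; rewrite permtM scalerA odd_permM signr_addb mulrA -signr_addb addbb mul1r.
Qed.

Lemma dot_symR (u T : gtensor 'I_d) : dot (R u) T = dot u (R T).
Proof.
rewrite dotC /symR !linear_sum [RHS](reindex_inj invg_inj) /=; apply: eq_big => s.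
  by rewrite rowstabV.
by move=> _; rewrite dotC dot_permt.
Qed.

Lemma dot_antiC (u T : gtensor 'I_d) : dot (C u) T = dot u (C T).
Proof.
rewrite dotC /antiC !linear_sum [RHS](reindex_inj invg_inj) /=; apply: eq_big => s.
  by rewrite colstabV.
by move=> _; rewrite !linearZ /= odd_permV dotC dot_permt.
Qed.

Lemma permt_antiC s (T : gtensor 'I_d) :
  colstab lam s -> permt d s (C T) = (-1) ^+ s *: C T.
Proof.
move=> hs; apply: dot_inj => X.
rewrite dot_permt dot_antiC antiC_permt ?colstabV // odd_permV linearZ /=.
by rewrite [in RHS]dotC linearZ /= dotC dot_antiC.
Qed.

Lemma permt_symR s (T : gtensor 'I_d) : rowstab lam s -> permt d s (R T) = R T.
Proof.
by move=> hs; apply: dot_inj => X; rewrite dot_permt dot_symR symR_permt ?rowstabV // dot_symR.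
Qed.

(** The order of the column group, not the number of columns; [nrows] is likewise the order of the
    row group. They are the scalars by which [antiC] and [symR] act on their own images. *)
Definition ncols : F := #|[pred s : 'S_d | colstab lam s]|%:R.
Definition nrows : F := #|[pred s : 'S_d | rowstab lam s]|%:R.

Lemma antiC_id (T : gtensor 'I_d) :
  (forall s, colstab lam s -> permt d s T = (-1) ^+ s *: T) -> C T = ncols *: T.
Proof.
move=> h; rewrite /antiC (eq_bigr (fun=> T)) => [|s hs].
  by rewrite sumr_const /ncols scaler_nat; congr (_ *+ _); apply: eq_card.
by rewrite h // scalerA -signr_addb addbb scale1r.
Qed.

Lemma symR_id (T : gtensor 'I_d) :
  (forall s, rowstab lam s -> permt d s T = T) -> R T = nrows *: T.
Proof.
move=> h; rewrite /symR (eq_bigr (fun=> T)) // sumr_const /nrows scaler_nat.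
by congr (_ *+ _); apply: eq_card.
Qed.

Lemma antiCK (T : gtensor 'I_d) : C (C T) = ncols *: C T.
Proof. by apply: antiC_id => s; exact: permt_antiC. Qed.
Lemma symRK (T : gtensor 'I_d) : R (R T) = nrows *: R T.
Proof. by apply: symR_id => s; exact: permt_symR. Qed.

Lemma tact_symR N (T : gtensor 'I_d) : tact N (R T) = R (tact N T).
Proof. by rewrite /symR linear_sum /=; apply: eq_bigr => s _; rewrite tact_permt. Qed.
Lemma tact_antiC N (T : gtensor 'I_d) : tact N (C T) = C (tact N T).
Proof.
by rewrite /antiC linear_sum /=; apply: eq_bigr => s _; rewrite linearZ /= tact_permt.
Qed.

Hypothesis HF : has_pchar0 F.
Lemma ncols_neq0 : ncols != 0.
Proof.
rewrite /ncols (proj1 (pcharf0P F) HF) -lt0n; apply/card_gt0P; exists 1%g; exact: colstab1.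
Qed.
Lemma nrows_neq0 : nrows != 0.
Proof.
rewrite /nrows (proj1 (pcharf0P F) HF) -lt0n; apply/card_gt0P; exists 1%g; exact: rowstab1.
Qed.

End Stab.

(** In the Leibniz expansion, the zero entries between different columns of the tableau discard
    every permutation outside the column group. *)
Lemma antiC_decE lam (y : 'I_(sumn lam) -> 'I_n -> F) (i : {ffun 'I_(sumn lam) -> 'I_n}) :
  antiC lam (dec y) i =
  \det (\matrix_(k, k') if colof lam k == colof lam k' then y k (i k') else 0).
Proof.
rewrite /antiC sum_ffunE /determinant big_mkcond; apply: eq_bigr => s _.
rewrite !ffunE /GRing.scale /=; case: ifPn => hs.
  congr (_ * _); apply: eq_bigr => k _; rewrite mxE ffunE.
  by move/colstabP: hs => ->; rewrite eqxx.
have /forallPn[k kne] := hs.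
by rewrite (bigD1 k) //= mxE eq_sym (negbTE kne) mul0r mulr0.
Qed.

(** Vanishing is required only above the diagonal blocks, so the matrix is block lower triangular
    and the first block splits off at each step of the induction. *)
Lemma det_blocks (hs : seq nat) (f : nat -> nat -> F) (d : nat) : d = sumn hs ->
  (forall c i j, (i < sumn (take c hs) <= j)%N -> (j < sumn hs)%N -> f i j = 0) ->
  \det (\matrix_(i < d, j < d) f i j) =
  \prod_(c < size hs) \det (\matrix_(r < nth 0%N hs c, s < nth 0%N hs c)
                           f (sumn (take c hs) + r)%N (sumn (take c hs) + s)%N).
Proof.
move=> ->; elim: hs f => [|h hs IH] f f0 /=.
  by rewrite big_ord0 (flatmx0 (\matrix_(_, _) _)) -[X in \det X](flatmx0 1%:M) det1.
rewrite big_ord_recl /= -[LHS]/(\det (\matrix_(i < h + sumn hs, j < h + sumn hs) f i j)).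
rewrite -[X in \det X]submxK.
have -> : ursubmx (\matrix_(i < h + sumn hs, j < h + sumn hs) f i j) = 0.
  apply/matrixP=> i j; rewrite !mxE; apply: (f0 1%N) => /=; last by rewrite ltn_add2l.
  by rewrite take0 /= addn0 ltn_ord leq_addr.
rewrite det_lblock; congr (_ * _).
  by congr (\det _); apply/matrixP=> r s; rewrite !mxE.
have IH' := IH (fun i j => f (h + i)%N (h + j)%N).
rewrite (_ : drsubmx _ = \matrix_(i < sumn hs, j < sumn hs) f (h + i)%N (h + j)%N).
  rewrite IH' => [|c i j /andP[ic cj] js].
    apply: eq_bigr => c _; congr (\det _); apply/matrixP=> r s.
    by rewrite !mxE /= !addnA.
  by apply: (f0 c.+1); rewrite /= ?ltn_add2l ?leq_add2l ?ic.
by apply/matrixP=> r s; rewrite !mxE.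
Qed.

(** The product of the column determinants is the determinant of one block diagonal matrix, whose
    Leibniz expansion is the sum over the column group. *)
Lemma rank1E lam (v : 'M[F]_(size lam, n)) : is_part lam ->
  rank1 lam v = antiC lam (dec (fun k : 'I_(sumn lam) => vcoord v (rowof lam k))).
Proof.
move=> pl; apply/ffunP=> i; rewrite antiC_decE ffunE.
pose f p q := if colof lam p == colof lam q then
  oapp (fun q' => vcoord v (rowof lam p) (i q')) 0 (insub q : option 'I_(sumn lam)) else 0.
rewrite (_ : \matrix_(_, _) _ = \matrix_(k < sumn lam, k' < sumn lam) f k k').
  rewrite (@det_blocks (Defs.conj lam)) ?sumn_conj // => [|c p q /andP[pc cq] qs].
    apply: eq_bigr => c _; congr (\det _); apply/matrixP=> r s; rewrite !mxE /f.
    by rewrite !colof_box // eqxx rowof_box.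
  rewrite -/(offset lam c) in pc cq; have ps := ltn_trans (leq_trans pc cq) qs.
  rewrite /f; case: eqP => // e.
  have [_ p1 p2] := colof_bounds pl ps; have [_ q1 q2] := colof_bounds pl qs.
  have := leq_ltn_trans p1 pc; have := leq_ltn_trans cq q2; rewrite -e => h1 h2.
  case: (leqP c (colof lam p)) => cc.
    by rewrite ltnNge offset_homo in h2.
  by rewrite ltnNge (offset_homo lam cc) in h1.
by apply/matrixP=> k k'; rewrite !mxE /f valK.
Qed.

End Tensors.

Local Opaque symR antiC.

(** * Rank one tensors span the Schur module *)

Section Rank1.
Context {F : fieldType} {n : nat}.
Local Notation gtensor K := {ffun {ffun K%type -> 'I_n} -> F^o}.
Variable lam : seq nat.
Hypothesis plam : is_part lam.
Local Notation d := (sumn lam).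
Local Notation R := (@symR F n lam).
Local Notation C := (@antiC F n lam).

Lemma vcoordE h (v : 'M[F]_(h, n)) (r : 'I_h) k : vcoord v r k = v r k.
Proof. by rewrite /vcoord valK. Qed.

Lemma vcoord_over h (v : 'M[F]_(h, n)) r k : (h <= r)%N -> vcoord v r k = 0.
Proof. by move=> hr; rewrite /vcoord insubF // ltnNge hr. Qed.

Lemma vcoord_mulmx h (v : 'M[F]_(h, n)) (N : 'M[F]_n) r k :
  vcoord (v *m N) r k = \sum_a vcoord v r a * N a k.
Proof.
case: (ltnP r h) => rh; last first.
  by rewrite vcoord_over // big1 // => a _; rewrite vcoord_over // mul0r.
rewrite (vcoordE _ (Ordinal rh)) mxE; apply: eq_bigr => a _.
by rewrite (vcoordE _ (Ordinal rh)).
Qed.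

Lemma tact_rank1 (v : 'M[F]_(size lam, n)) N : rank1 lam (v *m N) = tact N (rank1 lam v).
Proof.
rewrite !rank1E // tact_antiC tact_dec; congr (C _).
by apply: eq_dec => k b; rewrite vcoord_mulmx.
Qed.

(** A column of length h sees only the first h vectors, and a lower triangular [L] combines these
    among themselves; the determinant of that column is multiplied by the leading h by h minor of
    [L]. *)
Lemma rank1_lower (L : 'M[F]_(size lam)) (delta : nat -> F) (v : 'M[F]_(size lam, n)) :
  (forall i j : 'I_(size lam), (i < j)%N -> L i j = 0) ->
  (forall i : 'I_(size lam), L i i = delta i) ->
  rank1 lam (L *m v) =
  (\prod_(c < size (Defs.conj lam)) \prod_(r < nth 0%N (Defs.conj lam) c) delta r) *: rank1 lam v.
Proof.
move=> Ltrig Ldiag; apply/ffunP=> i; rewrite !ffunE /GRing.scale /= -big_split /=.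
apply: eq_bigr => c _; have hs := nth_conj_le c plam.
pose h := nth 0%N (Defs.conj lam) c; rewrite -/h in hs *.
pose w := widen_ord hs.
have -> : \prod_(r < h) delta r = \det (\matrix_(r < h, t < h) L (w r) (w t)).
  rewrite det_trig; first by apply: eq_bigr => r _; rewrite mxE Ldiag.
  by apply/is_trig_mxP => r t rt; rewrite mxE Ltrig.
rewrite -det_mulmx; congr (\det _); apply/matrixP=> r s; rewrite !mxE.
under [RHS]eq_bigr do rewrite !mxE.
case: insubP => [q _ _|_] /=; last by rewrite big1 // => t _; rewrite mulr0.
rewrite (vcoordE _ (w r)) mxE (bigID (fun t : 'I__ => (t < h)%N)) /= [X in _ + X]big1 ?addr0.
  rewrite (big_ord_narrow hs) /=; apply: eq_bigr => t _.
  by rewrite (vcoordE v (w t)).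
move=> t; rewrite -leqNgt => ht; rewrite Ltrig ?mul0r //.
exact: leq_trans (ltn_ord r) ht.
Qed.

Definition rowsum (w : {ffun 'I_d -> 'I_n}) (e : {ffun 'I_d -> bool}) : 'M[F]_(size lam, n) :=
  \matrix_(r, b) \sum_(k | e k && (rowof lam k == r)) (b == w k)%:R.

(* Polarization: expanding each factor of the rank one tensors on the right, a
   row-preserving map phi : boxes -> boxes survives the alternating sum over
   subsets e of boxes only if phi is onto. *)
Lemma symR_word (w : {ffun 'I_d -> 'I_n}) :
  R (word w) = \sum_(e : {ffun 'I_d -> bool}) (\prod_k (-1) ^+ (~~ e k)) *:
                 dec (fun k : 'I_d => vcoord (rowsum w e) (rowof lam k)).
Proof.
apply/ffunP=> i; rewrite [RHS]sum_ffunE.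
pose G (k k' : 'I_d) : F := (rowof lam k' == rowof lam k)%:R * (i k == w k')%:R.
transitivity (\sum_(phi : {ffun 'I_d -> 'I_d})
    (injectiveb phi)%:R * \prod_k G k (phi k)); last first.
  transitivity (\sum_(e : {ffun 'I_d -> bool}) (\prod_k (-1) ^+ (~~ e k)) *
     \sum_(phi : {ffun 'I_d -> 'I_d}) \prod_k ((e (phi k))%:R * G k (phi k))); last first.
    apply: eq_bigr => e _; rewrite !ffunE /GRing.scale /=; congr (_ * _).
    rewrite -(bigA_distr_bigA (fun k k' => (e k')%:R * G k k')); apply: eq_bigr => k _.
    rewrite (vcoordE _ (Ordinal (rowof_lt_size k plam))) mxE [RHS]big_mkcond.
    apply: eq_bigr => k' _; rewrite /G /=.
    by case: (e k'); case: eqP => //= _; rewrite ?mul1r ?mul0r.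
  under [RHS]eq_bigr do rewrite mulr_sumr.
  rewrite [RHS]exchange_big /=; apply: eq_bigr => phi _.
  under [RHS]eq_bigr do rewrite big_split mulrA.
  rewrite -mulr_suml; congr (_ * _).
  transitivity (\sum_(e : {ffun 'I_d -> bool})
      \prod_j ((-1) ^+ (~~ e j) * ((j \notin codom phi) || e j)%:R : F)).
    rewrite -(bigA_distr_bigA (fun j b => (-1) ^+ (~~ b) * ((j \notin codom phi) || b)%:R : F)).
    transitivity (\prod_j ((j \in codom phi)%:R : F)); last first.
      apply: eq_bigr => j _; rewrite big_bool /= expr0 expr1 orbT orbF mulr1.
      by case: (j \in codom phi); rewrite /= ?mulr0 ?addr0 ?mulr1 ?subrr.
    case: injectiveP => [phi_inj|phi_ninj].
      by rewrite big1 // => j _; rewrite (injF_onto phi_inj).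
    have /forallPn[j jn] : ~~ [forall j, j \in codom phi].
      apply/negP=> /forallP jall; apply: phi_ninj.
      have /image_injP : #|image phi 'I_d| == #|'I_d|.
        by apply/eqP; apply: eq_card => j; rewrite jall.
      by move=> h x y; apply: h.
    by rewrite (bigD1 j) //= (negbTE jn) mul0r.
  apply: eq_bigr => e _; rewrite big_split /=; congr (_ * _).
  have [/forallP eall|/forallPn[k ek]] := boolP [forall k, e (phi k)].
    rewrite !big1 // => [k _|j _]; first by rewrite eall.
    case: (boolP (j \in codom phi)) => //= /codomP[k ->]; by rewrite eall.
  rewrite [RHS](bigD1 k) //= (negbTE ek) mul0r (bigD1 (phi k)) //=.
  by rewrite codom_f (negbTE ek) mul0r.
rewrite symRE.
rewrite [RHS](bigID (fun phi : {ffun 'I_d -> 'I_d} => injectiveb phi)) /=.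
rewrite [X in _ + X]big1 ?addr0; last by move=> phi /negbTE->; rewrite mul0r.
rewrite (reindex_inj invg_inj) /= [RHS](reindex (@pval _)) /=; last first.
  pose ip (phi : {ffun 'I_d -> 'I_d}) : 'S_d := insubd (1%g : 'S_d) phi.
  by exists ip => s si; [exact: valKd | exact: insubdK].
rewrite big_mkcond [RHS]big_mkcond /=; apply: eq_bigr => s _.
rewrite rowstabV (valP s) mul1r; case: ifPn => [/rowstabP hs|/forallPn[k kn]].
  rewrite ffunE (reindex_inj (@perm_inj _ s)) /=; apply: eq_bigr => k _.
  by rewrite /G ffunE permK pvalE hs eqxx mul1r.
by rewrite (bigD1 k) //= /G pvalE (negbTE kn) !mul0r.
Qed.

Lemma Schur_ind (P : gtensor 'I_d -> Prop) :
  P 0 -> (forall (t : F) x y, P x -> P y -> P (t *: x + y)) ->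
  (forall v, P (rank1 lam v)) -> forall z, SchurMod lam z -> P z.
Proof.
move=> P0 Plin Pr _ [U ->].
have Psum (I : finType) (G : I -> gtensor 'I_d) : (forall i, P (G i)) -> P (\sum_i G i).
  move=> PG; apply: big_ind => // x y Px Py.
  by rewrite -[x]scale1r; exact: Plin.
have Psc (t : F) x : P x -> P (t *: x) by move=> Px; rewrite -[_ *: _]addr0; exact: Plin.
rewrite [U]tensor_words (linear_sum R) (linear_sum C) /=; apply: (Psum _ (fun w => _)) => w.
rewrite !linearZ /=; apply: (Psc); rewrite symR_word (linear_sum C) /=; apply: (Psum _ (fun e => _)) => e.
by rewrite linearZ /=; apply: Psc; rewrite -rank1E.
Qed.

(** A decomposable tensor that is constant along rows is fixed by the row group, so dividing it by
    the order of that group gives a preimage. *)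
Lemma SchurMod_rank1 v : has_pchar0 F -> SchurMod lam (rank1 lam v : gtensor 'I_d).
Proof.
move=> HF; rewrite rank1E //; set U := dec _.
exists ((nrows lam)^-1 *: (U : gtensor 'I_d)).
rewrite linearZ /= symR_id ?scalerA ?mulVf ?scale1r ?nrows_neq0 // => s /rowstabP hs.
apply/ffunP=> i; rewrite !ffunE [RHS](reindex_inj (@perm_inj _ s)) /=.
by apply: eq_bigr => k _; rewrite ffunE hs.
Qed.

End Rank1.

(** * The highest weight vector *)

Section HighestWeight.
Context {F : fieldType} {n : nat}.
Hypothesis HF : has_pchar0 F.
Local Notation gtensor K := {ffun {ffun K%type -> 'I_n} -> F^o}.
Variable lam : seq nat.
Hypothesis plam : is_part lam.
Local Notation d := (sumn lam).
Local Notation R := (@symR F n lam).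
Local Notation C := (@antiC F n lam).

(* Induction on r: the boxes with entries r' < r occupy lam_r' distinct columns
   of length > r', hence all of them. *)
Lemma entries_in_columns (f : 'I_d -> nat) :
  (forall k k' : 'I_d, colof lam k = colof lam k' -> f k = f k' -> k = k') ->
  (forall r, #|[set k | f k == r]| = nth 0%N lam r) ->
  forall k : 'I_d, (f k < nth 0%N (Defs.conj lam) (colof lam k))%N.
Proof.
move=> finj fcard k; move: {-1}(f k) (erefl (f k)) => r; move: k.
elim/ltn_ind: r => r IH k fk.
have full r' c : (r' < r)%N -> (r' < nth 0%N (Defs.conj lam) c)%N ->
    exists k', f k' = r' /\ colof lam k' = c.
  move=> r'r r'c; rewrite ltn_conj // in r'c.
  pose A := [set k' | f k' == r'].
  have colA k' : k' \in A -> (colof lam k' < nth 0%N lam r')%N.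
    by rewrite inE -ltn_conj // => /eqP e; exact: (IH r').
  pose g (k' : 'I_d) : 'I_(nth 0%N lam r') := insubd (Ordinal r'c) (colof lam k').
  have gA : {in A &, injective g}.
    move=> x y xA yA /(congr1 val); rewrite !val_insubd !colA // => e; apply: finj => //.
    by move: xA yA; rewrite !inE => /eqP-> /eqP->.
  have : g @: A = setT.
    by apply/eqP; rewrite eqEcard subsetT cardsT card_ord card_in_imset ?fcard /=.
  move/setP/(_ (Ordinal r'c)); rewrite inE => /imsetP[x xA /(congr1 val)].
  rewrite val_insubd colA //= => e; exists x; split=> //.
  by move: xA; rewrite inE => /eqP.
rewrite ltnNge; apply/negP=> le_r; set c := colof lam k in le_r.
have ex (r' : 'I_(nth 0%N (Defs.conj lam) c)) : exists k', f k' = r' /\ colof lam k' = c.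
  by apply: full => //; exact: leq_trans (ltn_ord r') le_r.
have /fin_all_exists[h hP] := ex.
have hinj : injective h by move=> x y e; apply: val_inj; rewrite /= -(hP x).1 -(hP y).1 e.
have : h @: setT \subset [set k' : 'I_d | colof lam k' == c] :\ k.
  apply/subsetP=> _ /imsetP[x _ ->]; rewrite !inE (hP x).2 eqxx andbT.
  apply/eqP=> e; have := (hP x).1; rewrite e fk => xr.
  by have := ltn_ord x; rewrite -xr ltnNge le_r.
move/subset_leq_card; rewrite card_imset // cardsT card_ord.
by have := cardsD1 k [set k' : 'I_d | colof lam k' == c]; rewrite card_col // inE eqxx add1n => ->; rewrite ltnn.
Qed.

(** With [weightOK] and [col_alternating], this cuts out the column-alternating tensors of weight
    lambda, which form the line of the highest weight vector ([alternating_weight]). *)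
Definition contentOK (i : {ffun 'I_d -> 'I_n}) :=
  forall r, #|[set k | i k == r :> nat]| = nth 0%N lam r.
Definition weightOK (T : gtensor 'I_d) := forall i, T i != 0 -> contentOK i.
Definition col_alternating (T : gtensor 'I_d) :=
  forall s, colstab lam s -> permt d s T = (-1) ^+ s *: T.

Lemma contentOK_perm (i : {ffun 'I_d -> 'I_n}) (s : 'S_d) :
  contentOK [ffun k => i (s k)] -> contentOK i.
Proof.
move=> h r; rewrite -h -[RHS](card_imset _ (@perm_inj _ s)); apply: eq_card => k.
rewrite [LHS]inE; apply/idP/imsetP => [e|[k' + ->]]; last by rewrite inE ffunE.
by exists (s^-1%g k); rewrite ?permKV // inE ffunE permKV.
Qed.

Lemma weightOK_symR (T : gtensor 'I_d) : weightOK T -> weightOK (R T).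
Proof.
move=> h i; rewrite symRE => nz.
have [s _ /h]: exists2 s, rowstab lam s & T [ffun k => i (s k)] != 0.
  apply/exists_inP; apply: contraNT nz; rewrite negb_exists_in => /forall_inP z.
  by rewrite big1 // => s /z; rewrite negbK => /eqP.
exact: contentOK_perm.
Qed.

Lemma weightOK_antiC (T : gtensor 'I_d) : weightOK T -> weightOK (C T).
Proof.
move=> h i; rewrite antiCE => nz.
have [s _ /h]: exists2 s, colstab lam s & T [ffun k => i (s k)] != 0.
  apply/exists_inP; apply: contraNT nz; rewrite negb_exists_in => /forall_inP z.
  by rewrite big1 // => s /z; rewrite negbK => /eqP->; rewrite mulr0.
exact: contentOK_perm.
Qed.

Lemma alternating_tperm (T : gtensor 'I_d) (i : {ffun 'I_d -> 'I_n}) (k k' : 'I_d) :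
  col_alternating T -> k != k' -> colof lam k = colof lam k' -> i k = i k' -> T i = 0.
Proof.
move=> aT kk ck ik.
have st : colstab lam (tperm k k').
  by apply/colstabP=> x; case: tpermP => // ->.
have /ffunP/(_ i) := aT _ st; rewrite odd_tperm kk expr1 scaleN1r !ffunE.
have -> : [ffun x => i (tperm k k' x)] = i.
  by apply/ffunP=> x; rewrite ffunE; case: tpermP => // ->.
move/eqP; rewrite -subr_eq0 opprK -mulr2n -mulr_natr mulf_eq0.
by rewrite (proj1 (pcharf0P F) HF) orbF => /eqP.
Qed.

Hypothesis len : (size lam <= n)%N.
Definition hw_word : {ffun 'I_d -> 'I_n} :=
  [ffun k => widen_ord len (Ordinal (rowof_lt_size k plam))].
Definition std_frame : 'M[F]_(size lam, n) := \matrix_(r, b) (b == r :> nat)%:R.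
Definition hw_vector : gtensor 'I_d := rank1 lam std_frame.

Lemma std_frameK : std_frame *m std_frame^T = 1%:M.
Proof.
apply/matrixP=> r s; rewrite !mxE (bigD1 (widen_ord len r)) //= big1 => [|b br].
  by rewrite !mxE eqxx mul1r addr0.
rewrite !mxE (_ : (b == r :> nat) = false) ?mul0r //.
by apply: contra_neqF br => /eqP e; apply: val_inj.
Qed.

Lemma vcoord_std (X : 'M[F]_n) r b :
  (r < size lam)%N -> vcoord (std_frame *m X) r b = vcoord X r b.
Proof.
move=> rl; rewrite (vcoordE _ (Ordinal rl)) (vcoordE _ (Ordinal (leq_trans rl len))) mxE.
rewrite (bigD1 (Ordinal (leq_trans rl len))) //= big1 ?addr0 => [|a ar].
  by rewrite !mxE eqxx mul1r.
rewrite !mxE (_ : (a == r :> nat) = false) ?mul0r //.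
by apply: contra_neqF ar => /eqP e; apply: val_inj.
Qed.

(** The first rows of a lower triangular matrix vanish outside the leading block, so [L] can be
    moved to the left of the frame, where [rank1_lower] applies. *)
Lemma std_frame_lower (L : 'M[F]_n) : (forall i j : 'I_n, (i < j)%N -> L i j = 0) ->
  std_frame *m L = (\matrix_(r, t) L (widen_ord len r) (widen_ord len t)) *m std_frame.
Proof.
move=> Ll; apply/matrixP=> r b; rewrite -(vcoordE (_ *m _)) vcoord_std //.
rewrite (vcoordE _ (widen_ord len r)) mxE.
have [bl|lb] := ltnP b (size lam).
  rewrite (bigD1 (Ordinal bl)) //= big1 ?addr0 => [|t tb]; last first.
    rewrite !mxE (_ : (b == t :> nat) = false) ?mulr0 //.
    by apply: contra_neqF tb => /eqP e; apply: val_inj.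
  by rewrite !mxE eqxx mulr1; congr (L _ _); apply: val_inj.
rewrite big1 => [|t _]; first by rewrite Ll // (leq_trans (ltn_ord r)).
rewrite !mxE (_ : (b == t :> nat) = false) ?mulr0 //.
by apply/negbTE; rewrite neq_ltn (leq_trans (ltn_ord t) lb) orbT.
Qed.

Lemma hw_vectorE : hw_vector = C (word hw_word).
Proof.
rewrite /hw_vector rank1E //; congr (C _); apply: eq_dec => k b.
by rewrite (vcoordE _ (Ordinal (rowof_lt_size k plam))) mxE ffunE.
Qed.

Lemma hw_content : contentOK hw_word.
Proof. by move=> r; rewrite -card_row //; apply: eq_card => k; rewrite !inE ffunE. Qed.

Lemma weight_hw : weightOK hw_vector.
Proof.
rewrite hw_vectorE; apply: weightOK_antiC => i.
rewrite wordE; case: (eqVneq i hw_word) => [-> _|_ /eqP//]; exact: hw_content.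
Qed.

Lemma hw_vector_hw : hw_vector hw_word = 1.
Proof.
rewrite hw_vectorE antiCE (bigD1 1%g) ?colstab1 //= big1 => [|s /andP[/colstabP cs s1]].
  rewrite addr0 odd_perm1 mul1r wordE; case: eqP => //.
  by case; apply/ffunP=> k; rewrite ffunE perm1.
rewrite wordE; case: eqP => [e|]; rewrite ?mulr0 //.
case/eqP: s1; apply/permP=> k; rewrite perm1; apply: (box_inj plam) => //.
by have /(congr1 (fun w : {ffun 'I_d -> 'I_n} => val (w k))) := e; rewrite !ffunE.
Qed.

(** By [entries_in_columns] the letter at a box is the row number of some box of the same column;
    sending the first box to the second is the permutation. *)
Lemma contentOK_col_perm (i : {ffun 'I_d -> 'I_n}) : contentOK i ->
  (forall k k' : 'I_d, colof lam k = colof lam k' -> i k = i k' -> k = k') ->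
  exists2 s, colstab lam s & [ffun k => hw_word (s k)] = i.
Proof.
move=> ci ii.
have finj (k k' : 'I_d) : colof lam k = colof lam k' -> i k = i k' :> nat -> k = k'.
  by move=> ck /val_inj ik; exact: ii.
have lt := entries_in_columns finj ci.
have ex (k : 'I_d) : exists k' : 'I_d, rowof lam k' = i k /\ colof lam k' = colof lam k.
  by apply: box_exists => //; rewrite -(ltn_conj _ _ plam); exact: lt.
have /fin_all_exists[g gP] := ex.
have ginj : injective g.
  by move=> x y e; apply: finj; rewrite -?(gP x).1 -?(gP x).2 e ?(gP y).1 ?(gP y).2.
exists (perm ginj); first by apply/colstabP=> k; rewrite permE (gP k).2.
by apply/ffunP=> k; apply: val_inj; rewrite !ffunE permE /= (gP k).1.
Qed.

(** A word of weight lambda either repeats a letter in a column, and has coefficient zero, or is a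
    column permutation of [hw_word], and its coefficient is forced by the sign rule. *)
Lemma alternating_weight (T : gtensor 'I_d) : col_alternating T -> weightOK T ->
  T = T hw_word *: hw_vector.
Proof.
move=> aT wT; apply/ffunP=> i; rewrite ffunE /GRing.scale /=.
have aH : col_alternating hw_vector.
  by move=> s cs; rewrite hw_vectorE permt_antiC.
have key : contentOK i -> T i = T hw_word * hw_vector i.
  move=> ci; have [/existsP[k /existsP[k' /and3P[kk /eqP ck /eqP ik]]]|nex] :=
    boolP [exists k : 'I_d, exists k' : 'I_d, [&& k != k', colof lam k == colof lam k' & i k == i k']].
    by rewrite !(alternating_tperm (i := i) _ kk) // mulr0.
  have [k k' ck ik|s cs ei] := contentOK_col_perm ci.
    apply/eqP; apply: contraNT nex => kk.
    by apply/existsP; exists k; apply/existsP; exists k'; rewrite kk ck ik !eqxx.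
  have /ffunP/(_ hw_word) := aT _ cs; have /ffunP/(_ hw_word) := aH _ cs.
  have pe (U : gtensor 'I_d) : permt d s U hw_word = U i by rewrite ffunE ei.
  have se (t : F) (U : gtensor 'I_d) : (t *: U) hw_word = t * U hw_word by rewrite ffunE.
  by rewrite !pe !se hw_vector_hw mulr1 => -> ->; rewrite mulrC.
have [T0|/wT/key//] := eqVneq (T i) 0.
have [H0|/weight_hw/key//] := eqVneq (hw_vector i) 0.
by rewrite T0 H0 mulr0.
Qed.

(** Since [F] is not ordered, integrality allows a sum of squares to be compared with 0 among the
    natural numbers. *)
Definition integral (T : gtensor 'I_d) := forall i, exists m : int, T i = m%:~R.

Lemma integral_symR_hw : integral (R hw_vector).
Proof.
have iw : integral (word hw_word) by move=> i; rewrite wordE; exists (i == hw_word : nat)%:Z; rewrite pmulrn.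
have iC : integral hw_vector.
  rewrite hw_vectorE => i; rewrite antiCE.
  apply: (big_ind (fun x : F => exists m : int, x = m%:~R)) => [|x y [a ->] [b ->]|s _]; first by exists 0.
    by exists (a + b); rewrite rmorphD.
  have [m ->] := iw [ffun k => i (s k)]; exists ((-1) ^+ s * m).
  by rewrite rmorphM rmorph_sign.
move=> i; rewrite symRE; apply: (big_ind (fun x : F => exists m : int, x = m%:~R)) => [|x y [a ->] [b ->]|s _]; first by exists 0.
  by exists (a + b); rewrite rmorphD.
exact: iC.
Qed.

Lemma sqr_intr_nat (m : int) : exists a : nat, (m%:~R : F) ^+ 2 = a%:R.
Proof.
case: m => a; first by exists (a ^ 2)%N; rewrite natrX pmulrn.
by exists (a.+1 ^ 2)%N; rewrite NegzE mulrNz sqrrN natrX pmulrn.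
Qed.

Definition kappa : F := (C (R hw_vector) : gtensor 'I_d) hw_word.

(* Up to a positive factor, kappa is the sum of the squares of the (integral)
   coordinates of the row symmetrization of the highest weight vector. *)
Lemma kappa_neq0 : kappa != 0.
Proof.
have e : nrows lam * kappa = \sum_i (R hw_vector i : F) ^+ 2.
  rewrite /kappa -dot_word dot_antiC -hw_vectorE.
  transitivity (dot (R hw_vector) (R hw_vector)); last by apply: eq_bigr => i _.
  by rewrite [RHS]dot_symR symRK linearZ /= -dot_symR.
have pos : exists2 a : nat, (0 < a)%N & \sum_i (R hw_vector i : F) ^+ 2 = a%:R.
  have /fin_all_exists[a aP] i : exists a : nat, (R hw_vector i : F) ^+ 2 = a%:R.
    by have [m ->] := integral_symR_hw i; exact: sqr_intr_nat.
  exists (\sum_i a i)%N; last by rewrite natr_sum; apply: eq_bigr => i _.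
  rewrite (bigD1 hw_word) //= ltn_addr // lt0n -(proj1 (pcharf0P F) HF) -aP expf_eq0 /=.
  (* The row group fixes [hw_word], so this coordinate is the order of the row group and its square
     is the positive term. *)
  rewrite symRE (eq_bigr (fun=> 1)) => [|s /rowstabP rs].
    have := nrows_neq0 lam HF; rewrite sumr_const /nrows.
    by congr (_ *+ _ != 0); apply: eq_card.
  rewrite -hw_vector_hw; congr (hw_vector _); apply/ffunP=> k; apply: val_inj.
  by rewrite !ffunE /= rs.
have [a a0 ea] := pos; apply/eqP=> k0; move: e; rewrite k0 mulr0 ea => /esym/eqP.
by rewrite (proj1 (pcharf0P F) HF) => /eqP a00; rewrite a00 in a0.
Qed.

Lemma antiC_symR_hw : C (R hw_vector) = kappa *: hw_vector.
Proof.
apply: alternating_weight; first by move=> s cs; exact: permt_antiC.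
by apply: weightOK_antiC; apply: weightOK_symR; exact: weight_hw.
Qed.

(** Both symmetrizers commute with [tact], and every rank one tensor is the image of [hw_vector]
    under some, possibly singular, matrix; the scalar found on [hw_vector] is thus the same
    everywhere. *)
Lemma young_kappa (z : gtensor 'I_d) : SchurMod lam z -> C (R z) = kappa *: z.
Proof.
move=> Sz; apply: (Schur_ind plam _ _ _ Sz (P := fun z => C (R z) = kappa *: z)) => [|t x y hx hy|v].
- by rewrite (linear0 R) /= (linear0 C) scaler0.
- by rewrite (linearP R) /= (linearP C) /= hx hy scalerDr !scalerA mulrC.
(* The frame completed by zero rows, through the default value of [vcoord]. *)
pose N : 'M[F]_n := \matrix_(a, b) vcoord v a b.
have -> : v = std_frame *m N.
  apply/matrixP=> r b; rewrite mxE (bigD1 (widen_ord len r)) //= big1 => [|a ar].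
    by rewrite !mxE eqxx mul1r addr0 (vcoordE v r).
  by rewrite !mxE (_ : (a == r :> nat) = false) ?mul0r //; apply: negbTE.
by rewrite tact_rank1 // -tact_symR -tact_antiC -linearZ /= -antiC_symR_hw.
Qed.

End HighestWeight.

(** * Contractions *)

Section Contraction.
Context {F : fieldType} {n : nat}.
Implicit Types (A B K : finType) (N : 'M[F]_n).
Local Notation gtensor K := {ffun {ffun K%type -> 'I_n} -> F^o}.

Definition wcat A K (i : {ffun A -> 'I_n}) (j : {ffun K -> 'I_n}) : {ffun A + K -> 'I_n} :=
  [ffun a => match a with inl a => i a | inr b => j b end].
Definition lword A K (w : {ffun A + K -> 'I_n}) : {ffun A -> 'I_n} := [ffun a => w (inl a)].
Definition rword A K (w : {ffun A + K -> 'I_n}) : {ffun K -> 'I_n} := [ffun a => w (inr a)].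

Lemma lword_cat A K i j : lword (@wcat A K i j) = i.
Proof. by apply/ffunP=> a; rewrite !ffunE. Qed.
Lemma rword_cat A K i j : rword (@wcat A K i j) = j.
Proof. by apply/ffunP=> a; rewrite !ffunE. Qed.
Lemma wcatK A K w : @wcat A K (lword w) (rword w) = w.
Proof. by apply/ffunP=> -[a|a]; rewrite !ffunE. Qed.

Lemma sum_wcat A K (f : {ffun A + K -> 'I_n} -> F) :
  \sum_w f w = \sum_i \sum_j f (wcat i j).
Proof.
rewrite pair_big /= (reindex (fun ij => wcat ij.1 ij.2)) //.
exists (fun w => (lword w, rword w)) => [[i j] _|w _] /=.
  by rewrite lword_cat rword_cat.
exact: wcatK.
Qed.

Lemma tact_wcat A K N (T : gtensor (A + K)) i j : tact N T (wcat i j) =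
  \sum_(i' : {ffun A -> 'I_n}) \sum_(j' : {ffun K -> 'I_n}) (\prod_k N (i' k) (i k)) * (\prod_k N (j' k) (j k)) * T (wcat i' j').
Proof.
rewrite ffunE sum_wcat; apply: eq_bigr => i' _; apply: eq_bigr => j' _.
congr (_ * _); rewrite big_sumType /=.
by congr (_ * _); apply: eq_bigr => k _; rewrite !ffunE.
Qed.

Definition contract A K (Q : gtensor (A + K)) (x : gtensor A) : gtensor K :=
  [ffun j : {ffun K -> 'I_n} => (\sum_i Q (wcat i j) * x i : F^o)].

Fact contract_is_linear A K (Q : gtensor (A + K)) : linear (contract Q).
Proof.
move=> t x y; apply/ffunP=> i; rewrite !ffunE scaler_sumr -big_split /=.
by apply: eq_bigr => j _; rewrite !ffunE /GRing.scale /= mulrDr mulrCA.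
Qed.
HB.instance Definition _ A K Q :=
  GRing.isLinear.Build F _ _ _ (@contract A K Q) (@contract_is_linear A K Q).

Lemma contract_tact A K N (Q : gtensor (A + K)) (x : gtensor A) :
  contract (tact N Q) x = tact N (contract Q (tact N^T x)).
Proof.
apply/ffunP=> j; rewrite !ffunE.
under eq_bigr do rewrite tact_wcat mulr_suml.
under [RHS]eq_bigr do rewrite ffunE mulr_sumr.
rewrite exchange_big /= [RHS]exchange_big /=; apply: eq_bigr => i' _.
under eq_bigr do rewrite mulr_suml.
rewrite exchange_big /=; apply: eq_bigr => j' _.
rewrite ffunE !mulr_sumr; apply: eq_bigr => i _.
have -> : \prod_k N^T (i k) (i' k) = \prod_k N (i' k) (i k).
  by apply: eq_bigr => k _; rewrite mxE.
by rewrite -!mulrA mulrCA; congr (_ * _); exact: mulrCA.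
Qed.

Definition tens A K (u : gtensor A) (v : gtensor K) : gtensor (A + K) :=
  [ffun w : {ffun A + K -> 'I_n} => (u (lword w) * v (rword w) : F^o)].

Lemma tensE A K (u : gtensor A) (v : gtensor K) i j : tens u v (wcat i j) = u i * v j.
Proof. by rewrite ffunE lword_cat rword_cat. Qed.

Lemma tact_tens A K N (u : gtensor A) (v : gtensor K) :
  tact N (tens u v) = tens (tact N u) (tact N v).
Proof.
apply/ffunP=> w; rewrite -(wcatK w) tact_wcat tensE !ffunE big_distrlr /=.
by apply: eq_bigr => i _; apply: eq_bigr => j _; rewrite tensE mulrACA.
Qed.

Fact tens_is_linear A K (u : gtensor A) : linear (tens u : gtensor K -> gtensor (A + K)).
Proof.
by move=> t x y; apply/ffunP=> w; rewrite !ffunE /GRing.scale /= mulrDr mulrCA.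
Qed.
HB.instance Definition _ A K u :=
  GRing.isLinear.Build F _ _ _ (@tens A K u) (@tens_is_linear A K u).

Lemma tens_linearl A K (t : F) (x y : gtensor A) (v : gtensor K) :
  tens (t *: x + y) v = t *: tens x v + tens y v.
Proof. by apply/ffunP=> w; rewrite !ffunE /GRing.scale /= mulrDl mulrA. Qed.

Lemma tens_dec A K (y : A -> 'I_n -> F) (z : K -> 'I_n -> F) :
  tens (dec y) (dec z) = dec (fun x => match x with inl a => y a | inr k => z k end).
Proof.
apply/ffunP=> w; rewrite !ffunE big_sumType /=.
by congr (_ * _); apply: eq_bigr => k _; rewrite ffunE.
Qed.

Lemma word_wcat A K (i : {ffun A -> 'I_n}) (j : {ffun K -> 'I_n}) :
  word (wcat i j) = tens (word i) (word j).
Proof.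
apply/ffunP=> w; rewrite -(wcatK w) tensE !wordE; move: (lword w) (rword w) => i' j'.
rewrite -natrM mulnb; congr (_ : bool)%:R; apply/eqP/andP => [e|[/eqP-> /eqP->]//].
by rewrite -(lword_cat i' j') e lword_cat -{1}(rword_cat i' j') e rword_cat.
Qed.

Lemma dot_contract A K (Q : gtensor (A + K)) (x : gtensor A) z :
  dot (contract Q x) z = dot Q (tens x z).
Proof.
rewrite /dot sum_wcat exchange_big /=; apply: eq_bigr => j _.
by rewrite ffunE mulr_suml; apply: eq_bigr => i _; rewrite tensE mulrA.
Qed.

Lemma linear_comb A B (f : gtensor A -> gtensor B) (I : finType) (P : pred I) (c : I -> F)
    (g : I -> gtensor A) : (forall t x y, f (t *: x + y) = t *: f x + f y) ->
  f (\sum_(i | P i) c i *: g i) = \sum_(i | P i) c i *: f (g i).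
Proof.
move=> flin; have f0 : f 0 = 0.
  by have := flin (-1) 0 0; rewrite scaler0 addr0 scaleN1r addNr.
elim: (index_enum _) => [|w r IH]; first by rewrite !big_nil.
by rewrite !big_cons; case: ifP => _; rewrite ?flin IH.
Qed.

Lemma linear_words A B (f : gtensor A -> gtensor B) (T : gtensor A) :
  (forall t x y, f (t *: x + y) = t *: f x + f y) -> f T = \sum_w T w *: f (word w).
Proof. by move=> flin; rewrite {1}[T]tensor_words linear_comb. Qed.

Lemma tact_diag K (delta : 'I_n -> F) (T : gtensor K) w :
  tact (diag_mx (\row_b delta b)) T w = (\prod_k delta (w k)) * T w.
Proof.
rewrite ffunE (bigD1 w) //= [X in _ + X]big1 ?addr0 => [|w' ww].
  by congr (_ * _); apply: eq_bigr => k _; rewrite !mxE eqxx.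
have /existsP[k kne] : [exists k, w' k != w k].
  rewrite -[X in is_true X]negbK negb_exists; apply/negP=> /forallP h.
  by case/eqP: ww; apply/ffunP=> k; apply/eqP; have := h k; rewrite negbK.
by rewrite (bigD1 k) //= !mxE (negbTE kne) mulr0n !mul0r.
Qed.

Definition count_letter K (h : 'I_n) (w : {ffun K -> 'I_n}) := #|[set k | w k == h]|.
Definition upd K (w : {ffun K -> 'I_n}) (k : K) (b : 'I_n) : {ffun K -> 'I_n} :=
  [ffun x => if x == k then b else w x].

Lemma prod_letter K (h : 'I_n) (w : {ffun K -> 'I_n}) (s t : F) :
  \prod_k (if w k == h then s * t else t) = s ^+ count_letter h w * t ^+ #|K|.
Proof.
rewrite (eq_bigr (fun k => (if w k == h then s else 1) * t)); last first.
  by move=> k _; case: ifP; rewrite ?mul1r.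
rewrite big_split /= prodr_const -big_mkcond /= prodr_const; congr (_ ^+ _ * _).
by apply: eq_card => k; rewrite inE.
Qed.

Lemma count_upd_in K (h j : 'I_n) (w : {ffun K -> 'I_n}) k :
  w k = h -> j != h -> (count_letter h w = (count_letter h (upd w k j)).+1)%N.
Proof.
move=> wk jh; rewrite /count_letter (cardsD1 k) inE wk eqxx add1n; congr _.+1.
by apply: eq_card => x; rewrite !inE ffunE; case: eqP => //= _; rewrite (negbTE jh).
Qed.

(* Invariance under the transvection sending the letter h to h + j: among the
   words obtained by replacing some of the h's by j, only those with e
   letters h left have a nonzero coefficient. *)
Lemma transvection_sum K (T : gtensor K) (h j : 'I_n) (e : nat) w :
  (h < j)%N -> (forall w, T w != 0 -> count_letter h w = e) ->
  tact (1%:M + delta_mx j h) T = T -> count_letter h w = e.+1 ->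
  \sum_(k | w k == h) T (upd w k j) = 0.
Proof.
move=> hj wT iT cw; have jh : j != h by rewrite neq_ltn hj orbT.
have Tw : T w = 0.
  by apply/eqP; apply: contraT => /wT; rewrite cw => /esym/n_Sn.
pose G (w' : {ffun K -> 'I_n}) : F := \prod_k (1%:M + delta_mx j h : 'M[F]_n) (w' k) (w k) * T w'.
have E : \sum_w' G w' = 0.
  by have := congr1 (fun U : gtensor K => U w) iT; rewrite Tw ffunE.
rewrite -[RHS]E.
have entry a b : (1%:M + delta_mx j h : 'M[F]_n) a b =
    (a == b)%:R + ((a == j) && (b == h))%:R by rewrite !mxE.
have uinj : {in [set k | w k == h] &, injective (fun k => upd w k j)}.
  move=> k k'; rewrite !inE => /eqP wk /eqP wk' /ffunP/(_ k); rewrite !ffunE eqxx.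
  by case: eqP => // _ e'; rewrite e' wk eqxx in jh.
transitivity (\sum_(w' in [set upd w k j | k in [set k | w k == h]]) G w').
  rewrite big_imset //=; apply: eq_big => [k|k /eqP wk]; first by rewrite inE.
  rewrite /G big1 ?mul1r // => x _; rewrite entry !ffunE.
  have [->|_] := eqVneq x k; last by rewrite eqxx; case: (eqVneq (w x) j) => [->|_];
    rewrite ?(negbTE jh) /= addr0.
  by rewrite wk eqxx (negbTE jh) eqxx add0r.
rewrite [RHS](bigID (mem [set upd w k j | k in [set k | w k == h]])) /=.
rewrite [X in _ = _ + X]big1 ?addr0 // => w' nim; apply/eqP; apply: contraNT nim.
rewrite mulf_eq0 negb_or => /andP[/prodf_neq0 nz /wT cw'].
have ch k : w' k != w k -> w' k = j /\ w k = h.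
  move=> ne; have := nz k isT; rewrite entry (negbTE ne) add0r.
  by case: (eqVneq (w' k) j) => [->|_]; case: (eqVneq (w k) h) => [->|_]; rewrite /= ?eqxx.
pose D := [set k | w' k != w k].
have Dsub : D \subset [set k | w k == h].
  by apply/subsetP=> k; rewrite !inE => /ch[_ ->].
have : #|D| = 1%N.
  have := cardsID D [set k | w k == h]; rewrite -/(count_letter h w) cw.
  rewrite (setIidPr Dsub) (_ : _ :\: D = [set k | w' k == h]).
    by rewrite -/(count_letter h w') cw' -addn1 addnC => /addnI.
  apply/setP=> k; rewrite !inE negbK; have [->|ne] := eqVneq (w' k) (w k); first by [].
  by have [-> _] := ch k ne; rewrite (negbTE jh).
move/eqP/cards1P => [k Dk]; have kD : k \in D by rewrite Dk inE.
have [w'k wk] : w' k = j /\ w k = h by apply: ch; rewrite inE in kD.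
apply/imsetP; exists k; first by rewrite inE wk.
apply/ffunP=> x; rewrite ffunE; case: eqP => [->//|/eqP xk].
have xD : x \notin D by rewrite Dk inE.
by move: xD; rewrite /D inE negbK => /eqP.
Qed.

(* Induction on the number of letters h in b: the transvections reduce a to the
   constant word h, which has too many letters h. *)
Lemma symmetric_vanish (m e : nat) K (T : gtensor ('I_m + K)) (h : 'I_n) :
  has_pchar0 F -> (e < m)%N ->
  (forall w, T w != 0 -> count_letter h w = e) ->
  (forall j : 'I_n, (h < j)%N -> tact (1%:M + delta_mx j h) T = T) ->
  (forall (a : {ffun 'I_m -> 'I_n}) b (s : 'S_m), T (wcat [ffun k => a (s k)] b) = T (wcat a b)) ->
  forall (a : {ffun 'I_m -> 'I_n}) b, (forall k, h <= a k)%N -> T (wcat a b) = 0.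
Proof.
move=> HF em wT iT sT a b; move: {2}(count_letter h b) (erefl (count_letter h b)) => N.
elim/ltn_ind: N a b => N IH a b cb ah; apply/eqP; apply/negPn/negP=> nz.
have cw := wT _ nz.
have [k0 k0h] : exists k, a k != h.
  apply/existsP; rewrite -[X in is_true X]negbK negb_exists; apply/negP=> /forallP all.
  move: em; rewrite -cw ltnNge; case/negP.
  have cm : #|[set @inl 'I_m K k | k in [set: 'I_m]]| = m.
    by rewrite card_imset ?cardsT ?card_ord // => x y [].
  apply: leq_trans (eq_leq (esym cm)) _.
  apply/subset_leq_card/subsetP=> _ /imsetP[k _ ->]; rewrite inE ffunE.
  by have := all k; rewrite negbK.
set j := a k0 in k0h; have hj : (h < j)%N by rewrite ltn_neqAle ah andbT eq_sym.
(* One [j] of [a] is turned into [h], so that [w1] has one letter [h] too many and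
   [transvection_sum] applies. Replacing an [h] inside [b] leaves fewer of them there, which the
   induction kills; replacing one inside [a1] gives [a] up to a permutation. A positive multiple of
   the coefficient therefore vanishes. *)
pose a1 := upd a k0 h; pose w1 := wcat a1 b.
have updl a' k' b' : upd (wcat a' b) (inl k') b' = wcat (upd a' k' b') b.
  by apply/ffunP=> -[x|x]; rewrite !ffunE.
have ea : upd a1 k0 j = a by apply/ffunP=> x; rewrite !ffunE; case: eqP => // ->.
have w1k : w1 (inl k0) = h by rewrite !ffunE eqxx.
have cw1 : count_letter h w1 = e.+1.
  by rewrite (count_upd_in w1k k0h) /w1 updl ea cw.
have := transvection_sum hj wT (iT j hj) cw1.
have -> : \sum_(k | w1 k == h) T (upd w1 k j) =
    \sum_(k | w1 (inl k) == h) T (upd w1 (inl k) j) +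
    \sum_(k | w1 (inr k) == h) T (upd w1 (inr k) j) by exact: big_sumType.
rewrite [X in _ + X]big1 => [|k /eqP wk]; last first.
  have -> : upd w1 (inr k) j = wcat a1 (upd b k j) by apply/ffunP=> -[x|x]; rewrite !ffunE.
  have bk : b k = h by rewrite -wk !ffunE.
  apply: (IH (count_letter h (upd b k j))) => //; first by rewrite -cb (count_upd_in bk k0h).
  by move=> x; rewrite ffunE; case: ifP.
rewrite addr0 (eq_bigr (fun=> T (wcat a b))) => [|k /eqP wk].
  rewrite sumr_const -mulr_natr => /eqP; rewrite mulf_eq0 (negbTE nz) (proj1 (pcharf0P F) HF) orFb.
  move/eqP/card0_eq/(_ k0) => c0; have : (w1 (inl k0) == h) = false by exact: c0.
  by rewrite w1k eqxx.
rewrite updl -(sT a b (tperm k0 k)); congr (T (wcat _ _)); apply/ffunP=> x.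
have a1k : a1 k = h by rewrite -wk !ffunE.
rewrite !ffunE; case: tpermP => [->|->|/eqP/negbTE xk0 /eqP/negbTE xk].
- rewrite eqxx; have [<-//|kk] := eqVneq k0 k.
  by move: a1k; rewrite ffunE eq_sym (negbTE kk) => ->.
- by rewrite eqxx.
- by rewrite xk xk0.
Qed.

End Contraction.

(** * The ideal of a point annihilates the point *)

Section LRSize.
Local Open Scope nat_scope.

Lemma sumn_nth_wide (s : seq nat) N : size s <= N -> sumn s = \sum_(i < N) nth 0 s i.
Proof.
move=> sN; rewrite sumnE (big_nth 0) big_mkord (big_ord_widen _ (nth 0 s) sN) big_mkcond /=.
by apply: eq_bigr => i _; case: ltnP => // h; rewrite nth_default.
Qed.

Lemma size_count (w : seq nat) N : all (fun x => 0 < x <= N) w ->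
  size w = \sum_(i < N) count_mem i.+1 w.
Proof.
elim: w => [|x w IH] /=; first by rewrite big1.
case/andP=> /andP[x0 xN] /IH ->; rewrite big_split /= -add1n; congr (_ + _).
case: x x0 xN => // x _ xN; rewrite (bigD1 (Ordinal xN)) //= eqxx big1 // => i ix.
by rewrite eqSS eq_sym; case: eqP => // e; case/eqP: ix; apply: val_inj.
Qed.

(** The reading word has one letter per box of c/a and, counted by values, as many letters as [b]
    has boxes. Additivity of degrees keeps the number of slots in [polar] equal to |lambda|. *)
Lemma LR_sumn a b c : LR_nonzero a b c -> sumn a + sumn b = sumn c.
Proof.
case=> -[sac ac] [T [Tpos _ _ Tcount _]].
set w := flatten _ in Tcount.
have wpos : all (fun x => 0 < x) w.
  apply/allP=> x /flattenP[s /mapP[r _ ->] /mapP[y]].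
  rewrite mem_rev mem_iota => /andP[ay yc] ->; apply: Tpos.
  by rewrite ay /=; rewrite subnKC // in yc.
(* A crude bound on the letters: each is at most the sum of all. *)
pose N := maxn (size b) (sumn w).
have wN : all (fun x => 0 < x <= N) w.
  apply/allP=> x xw; rewrite (allP wpos) //= leq_max.
  by rewrite (perm_sumn (perm_to_rem xw)) /= leq_addr orbT.
have <- : size w = sumn b.
  rewrite (size_count wN) (sumn_nth_wide (N := N)) ?leq_maxl //.
  by apply: eq_bigr => i _; rewrite Tcount.
rewrite (sumn_nth_wide sac) (sumn_nth_wide (leqnn (size c))).
rewrite /w size_flatten /shape -!map_comp sumnE big_map.
rewrite -[X in iota 0 X]subn0 -/(index_iota 0 (size c)) big_mkord -big_split /=; apply: eq_bigr => r _.
by rewrite size_map size_rev size_iota subnKC.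
Qed.

End LRSize.

Section Polar.
Context {F : fieldType} {n : nat}.
Hypothesis HF : has_pchar0 F.
Local Notation gtensor K := {ffun {ffun K%type -> 'I_n} -> F^o}.
Variable lam : seq nat.
Hypothesis plam : is_part lam.
Hypothesis len : (size lam < n)%N.
Local Notation E := (@std_frame F n lam).
Local Notation hw := (@hw_vector F n lam).
Variable p : gtensor 'I_(sumn lam).
Local Notation d := (sumn lam).

(** The index type [A] is arbitrary so that slots can be regrouped, and determinant one matches the
    equivariance demanded of multiplication maps. *)
Definition semi_invariant (A : finType) (Q : gtensor A) :=
  forall (gam : 'M[F]_n) chi, \det gam = 1 ->
    tact gam p = chi *: p -> tact gam Q = chi *: Q.

(* A graded subspace inside the apolar set of p whose closure under all
   multiplication maps is automatic: composing a semi-invariant form with an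
   equivariant map gives a semi-invariant form. *)
Definition polar (mu : seq nat) (x : tensor (sumn mu)) : Prop :=
  SchurMod mu x /\
  forall K : finType, (#|K| + sumn mu = d)%N ->
  forall Q : gtensor ('I_(sumn mu) + K), semi_invariant Q -> contract Q x = 0.

Lemma SchurMod0 (mu : seq nat) : SchurMod mu (0 : gtensor 'I_(sumn mu)).
Proof. by exists 0; rewrite (linear0 (symR mu)) (linear0 (antiC mu)). Qed.

Lemma SchurMod_lin (mu : seq nat) (t : F) (x y : gtensor 'I_(sumn mu)) :
  SchurMod mu x -> SchurMod mu y -> SchurMod mu (t *: x + y : gtensor _).
Proof.
move=> [U ->] [V ->]; exists (t *: (U : gtensor _) + V).
by rewrite (linearP (symR mu)) /= (linearP (antiC mu)).
Qed.

Lemma polar_graded : graded_subspace polar.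
Proof.
move=> mu _; split=> [|t x y [Sx Qx] [Sy Qy]|x []//].
  by split=> [|K _ Q _]; [exact: SchurMod0|exact: linear0].
split=> [|K dK Q sQ]; first exact: SchurMod_lin.
by rewrite (linearP (contract Q)) /= Qx // Qy // scaler0 addr0.
Qed.

(** The form [Q'] is [Q] composed with the product, living on the slots of [a], of [b] and of [K].
    With the slots of [b] counted as spare, its contraction with [x] vanishes; inserting [y] then
    gives the contraction of [Q] with the product of [x] and [y]. *)
Lemma polar_mult_closed : mult_closed polar.
Proof.
move=> a b c /andP[pa sa] /andP[pb sb] _ LR M [MS Ml Mr Meq] x y [Sx Qx] Sy.
split=> [|K dK Q sQ]; first exact: MS.
(* [M] is controlled only on Schur modules; precomposing with Young symmetrizers makes it bilinear
   and equivariant on all tensors, at the cost of the nonzero factors [kappa]. *)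
pose Ya (z : gtensor 'I_(sumn a)) : gtensor 'I_(sumn a) := antiC a (symR a z).
pose Yb (z : gtensor 'I_(sumn b)) : gtensor 'I_(sumn b) := antiC b (symR b z).
have YaS z : SchurMod a (Ya z) by exists z.
have YbS z : SchurMod b (Yb z) by exists z.
pose B (u : gtensor 'I_(sumn a)) (v : gtensor 'I_(sumn b)) : gtensor 'I_(sumn c) := M (Ya u) (Yb v).
have Bl v t u u' : B (t *: u + u') v = t *: B u v + B u' v.
  by rewrite /B -Ml //; congr (M _ _); rewrite /Ya (linearP (symR a)) /= (linearP (antiC a)).
have Br u t v v' : B u (t *: v + v') = t *: B u v + B u v'.
  by rewrite /B -Mr //; congr (M _ _); rewrite /Yb (linearP (symR b)) /= (linearP (antiC b)).
have Beq N u v : \det N = 1 -> B (tact N u) (tact N v) = tact N (B u v).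
  move=> dN; have uN : N \in unitmx by rewrite unitmxE dN unitr1.
  (* [actD] involves the inverse matrix, hence the inverse here. *)
  have := Meq (invmx N) _ (Ya u) (Yb v) (YaS u) (YbS v).
  rewrite !actDE invmxK det_inv dN invr1 /B => <- //.
  by congr (M _ _); rewrite /Ya /Yb tact_antiC tact_symR.
pose Q' : gtensor ('I_(sumn a) + ('I_(sumn b) + K)) :=
  [ffun w => contract Q (B (word (lword w)) (word (lword (rword w)))) (rword (rword w))].
have Q'P u v z : dot Q' (tens u (tens v z)) = dot (contract Q (B u v)) z.
  rewrite [RHS]dotC (linear_words (f := fun u => B u v)) //.
  rewrite (linear_sum (contract Q)) /= (linear_sum (dot z)) /= {1}/dot sum_wcat.
  apply: eq_bigr => i _; rewrite (linearZ_LR (contract Q)) /= (linearZ_LR (dot z)) /=.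
  rewrite (linear_words (f := B (word i))) //.
  rewrite (linear_sum (contract Q)) /= (linear_sum (dot z)) /= sum_wcat scaler_sumr.
  apply: eq_bigr => j _; rewrite (linearZ_LR (contract Q)) /= (linearZ_LR (dot z)) /=.
  rewrite /GRing.scale /= !mulr_sumr; apply: eq_bigr => l _.
  by rewrite !tensE ffunE !(lword_cat, rword_cat) mulrC -!mulrA [z l * _]mulrC.
have sQ' : semi_invariant Q'.
  move=> gam chi dg hp; apply/ffunP=> w; rewrite -!dot_word.
  rewrite -(wcatK w) -(wcatK (rword w)) !word_wcat.
  move: (word _) (word _) (word _) => u v z.
  rewrite dot_tact !tact_tens Q'P Beq ?det_tr // -dot_tact -contract_tact (sQ _ _ dg hp).
  rewrite !dot_contract -[LHS]dotC -[RHS]dotC !(linearZ_LR (dot _)) /=.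
  by rewrite [dot _ Q]dotC -dot_contract -Q'P dotC.
have dK' : (#|{: ('I_(sumn b) + K)%type}| + sumn a = d)%N.
  by rewrite card_sum card_ord -dK -(LR_sumn LR) addnC addnA [RHS]addnC.
have cz := Qx _ dK' Q' sQ'.
have cB : contract Q (B x y) = 0.
  by apply: dot_inj => z; rewrite -Q'P -dot_contract cz dotC [RHS]dotC !(linear0 (dot _)).
have BE : B x y = (kappa pa (ltnW sa) * kappa pb (ltnW sb)) *: (M x y : gtensor _).
  have M0l u v : SchurMod a u -> SchurMod b v -> forall t : F,
      M (t *: (u : gtensor _) : gtensor _) v = t *: (M u v : gtensor _).
    move=> Su Sv t; have := Ml t u 0 v Su (SchurMod0 a) Sv; rewrite addr0 => ->.
    have := Ml (-1) 0 0 v (SchurMod0 a) (SchurMod0 a) Sv.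
    by rewrite scaler0 addr0 scaleN1r addNr => ->; rewrite addr0.
  have M0r u v : SchurMod a u -> SchurMod b v -> forall t : F,
      M u (t *: (v : gtensor _) : gtensor _) = t *: (M u v : gtensor _).
    move=> Su Sv t; have := Mr t u v 0 Su Sv (SchurMod0 b); rewrite addr0 => ->.
    have := Mr (-1) u 0 0 Su (SchurMod0 b) (SchurMod0 b).
    by rewrite scaler0 addr0 scaleN1r addNr => ->; rewrite addr0.
  rewrite /B /Ya /Yb (young_kappa HF pa (ltnW sa)) // (young_kappa HF pb (ltnW sb)) //.
  rewrite M0l // ?M0r ?scalerA //.
  by have := SchurMod_lin (kappa pb (ltnW sb)) Sy (SchurMod0 b); rewrite addr0.
have := cB; rewrite BE (linearZ_LR (contract Q)) /= => /eqP.
by rewrite scaler_eq0 mulf_eq0 !(negbTE (kappa_neq0 HF _ _)) => /eqP.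
Qed.

Section Generators.
Variable v : 'M[F]_(size lam, n).
Hypotheses (fv : row_free v) (pv : p = rank1 lam v).

(** Completes the vectors of [p] to a basis adapted to its flag, so that [p] becomes [tact g] of the
    highest weight vector. *)
Lemma frame_extend : exists2 g : 'M[F]_n, g \in unitmx & v = E *m g.
Proof.
have EE : E *m E^T = 1%:M := std_frameK (ltnW len).
have rE : \rank E = size lam.
  apply/eqP; rewrite eqn_leq rank_leq_row -{1}(mxrank1 F (size lam)) -EE.
  exact: mxrankM_maxl.
have [|g ug eg] := @complete_unitmx _ _ _ (E) ((E)^T *m v).
  by rewrite mulmxA EE mul1mx rE; apply/eqP.
by exists g; rewrite // -eg mulmxA EE mul1mx.
Qed.

(** Conjugation by [g] transports the scaling condition from [p] to the highest weight vector. *)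
Lemma semi_invariant_frame (g : 'M[F]_n) (A : finType) (Q : gtensor A) :
  g \in unitmx -> v = E *m g -> semi_invariant Q ->
  forall (L : 'M[F]_n) chi, \det L = 1 ->
  tact L (hw) = chi *: hw ->
  tact L (tact (invmx g) Q) = chi *: tact (invmx g) Q.
Proof.
move=> ug vg sQ L chi dL hL; pose gam := invmx g *m L *m g.
have dg : \det gam = 1.
  by rewrite !det_mulmx dL mulr1 -det_mulmx mulVmx // det1.
have hp : tact gam p = chi *: p.
  rewrite pv vg tact_rank1 // tactM !mulmxA mulmxV // mul1mx -tactM.
  by rewrite -/hw hL linearZ.
by rewrite tactM -linearZ /= -(sQ _ _ dg hp) tactM /gam -!mulmxA mulmxV // mulmx1.
Qed.

Lemma hw_torus (h : 'I_n) (s t : F) :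
  tact (diag_mx (\row_b (if b == h then s * t else t))) (hw) =
  (s ^+ nth 0%N lam h * t ^+ d) *: hw :> gtensor _.
Proof.
apply/ffunP=> i; rewrite tact_diag [RHS]ffunE /GRing.scale /= prod_letter card_ord.
have [->|/(weight_hw plam (ltnW len)) ci] := eqVneq (hw i) 0.
  by rewrite !mulr0.
by rewrite -(ci h).
Qed.

Lemma hw_transvection (h j : 'I_n) : (h < j)%N ->
  tact (1%:M + delta_mx j h) (hw) = hw :> gtensor _.
Proof.
move=> hj; rewrite /hw_vector -tact_rank1 //.
rewrite (std_frame_lower (ltnW len)) => [|i k ik]; last first.
  rewrite !mxE -val_eqE /= (ltn_eqF ik) add0r; case: eqP => //= ij; case: eqP => //= kh.
  by move: ik; rewrite ij kh ltnNge ltnW.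
rewrite (rank1_lower plam (delta := fun=> 1)) => [|i k ik|i].
- by rewrite big1 ?scale1r // => c _; rewrite big1.
- rewrite !mxE -!val_eqE /= (ltn_eqF ik) add0r; case: eqP => //= ij; case: eqP => //= kh.
  by move: ik; rewrite ij kh ltnNge ltnW.
rewrite !mxE eqxx -!val_eqE /=; case: eqP => //= ij; last by rewrite addr0.
by case: eqP => [ih|]; rewrite ?addr0 //; move: hj; rewrite -ij -ih ltnn.
Qed.

Lemma natr_inj (a b : nat) : a%:R = b%:R :> F -> a = b.
Proof.
wlog ab : a b / (a <= b)%N => [W e|].
  by case/orP: (leq_total a b) => h; [exact: W|apply/esym/W].
move/eqP; rewrite eq_sym -subr_eq0 -natrB // (proj1 (pcharf0P F) HF) subn_eq0 => ba.
by apply/eqP; rewrite eqn_leq ab.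
Qed.

Lemma symR_row (m : nat) (s : 'S_(sumn [:: m])) : rowstab [:: m] s.
Proof.
have [m0|m0] := posnP m.
  by move: s; rewrite m0 => s; apply/rowstabP=> -[].
have pm : is_part [:: m] by rewrite /is_part /= m0.
have r0 (k : 'I_(sumn [:: m])) : rowof [:: m] k = 0%N.
  by have := rowof_lt_size k pm; case: (rowof _ _).
by apply/rowstabP=> k; rewrite !r0.
Qed.

Lemma antiC_row (m : nat) (T : gtensor 'I_(sumn [:: m])) : (0 < m)%N -> antiC [:: m] T = T.
Proof.
move=> m0; have pm : is_part [:: m] by rewrite /is_part /= m0.
apply/ffunP=> i; rewrite antiCE (bigD1 1%g) ?colstab1 //= big1 => [|s /andP[/colstabP cs]].
  rewrite addr0 odd_perm1 mul1r; congr (T _); apply/ffunP=> k; by rewrite ffunE perm1.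
case/eqP; apply/permP=> k; rewrite perm1; apply: (box_inj pm) => //.
by have /rowstabP := symR_row s; apply.
Qed.

(** Symmetrization is moved from the generator to the form, giving [S]. In adapted coordinates the
    covectors kill all letters below [h], while [symmetric_vanish] kills [S] on words whose first
    [m] letters are all at least [h]. *)
Lemma polar_contains_gens : contains_gens lam v polar.
Proof.
move=> c cs h m alpha Walpha; set x := symR _ _.
have hl : (h <= size lam)%N by exact: nth_conj_le.
(* The column length read as a letter: letters start at 0, so W_h is spanned by the letters below
   [h], and [h] is the first one outside. It exists, also for the longest columns, because
   [size lam < n]. *)
pose h' := Ordinal (leq_ltn_trans hl len).
have me : m = (nth 0%N lam h').+1 by rewrite /m count_conj.
have n0 : (0 < n)%N by exact: leq_ltn_trans len.
split; first by exists (dec alpha); rewrite antiC_row.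
move=> K dK Q sQ; have [g ug vg] := frame_extend.
pose Qh := tact (invmx g) Q.
pose sm (s : 'S_(sumn [:: m])) (k : 'I_(sumn [:: m]) + K) : 'I_(sumn [:: m]) + K :=
  match k with inl k => inl (s k) | inr k => inr k end.
have smb s : bijective (sm s).
  by exists (sm s^-1%g) => -[k|k] //=; rewrite ?permK ?permKV.
pose S := \sum_s reindex_tensor (sm s) Qh.
have SE (a : {ffun 'I_(sumn [:: m]) -> 'I_n}) b : S (wcat a b) = \sum_(s : 'S_(sumn [:: m])) Qh (wcat [ffun k => a (s k)] b).
  rewrite sum_ffunE; apply: eq_bigr => s _; rewrite ffunE; congr (Qh _).
  by apply/ffunP=> -[k|k]; rewrite !ffunE.
have inv L chi : \det L = 1 -> tact L (hw) = chi *: hw ->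
    tact L S = chi *: S.
  move=> dL hL; rewrite /S linear_sum scaler_sumr; apply: eq_bigr => s _ /=.
  by rewrite tact_reindex // (semi_invariant_frame ug vg sQ dL hL) linearZ.
have cardX : #|{: ('I_(sumn [:: m]) + K)%type}| = d by rewrite card_sum card_ord addnC.
have wS w : S w != 0 -> count_letter h' w = nth 0%N lam h'.
  have t0 : (2%:R : F) != 0 by rewrite (proj1 (pcharf0P F) HF).
  (* The determinant is s t^n = 1. The eigenvalue on a word is s^e t^d with e its number of letters
     [h']; t^d cancels because there are exactly d slots, and distinct powers of 2 are distinct in
     characteristic 0. *)
  pose s : F := 2%:R ^+ n; pose t : F := 2%:R^-1.
  have dL : \det (diag_mx (\row_b (if b == h' then s * t else t))) = 1.
    rewrite det_diag (eq_bigr (fun k => if [ffun b : 'I_n => b] k == h' then s * t else t)).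
      rewrite prod_letter card_ord /count_letter (_ : #|_| = 1%N).
        by rewrite expr1 /s /t exprVn mulfV // expf_neq0.
      by rewrite -(cards1 h'); apply: eq_card => k; rewrite !inE ffunE.
    by move=> k _; rewrite mxE ffunE.
  move=> Sw; have /ffunP/(_ w) := inv _ _ dL (hw_torus h' s t).
  rewrite tact_diag prod_letter cardX ffunE /GRing.scale /= => /(mulIf Sw).
  have td : t ^+ d != 0 by rewrite expf_neq0 // invr_eq0.
  move/(mulIf td); rewrite /s -!exprM -!natrX => /natr_inj/eqP.
  by rewrite eqn_exp2l // eqn_pmul2l // => /eqP.
have uS (j : 'I_n) : (h' < j)%N -> tact (1%:M + delta_mx j h') S = S.
  move=> hj; rewrite -[RHS]scale1r; apply: inv; last by rewrite scale1r hw_transvection.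
  rewrite det_trig => [|].
    apply: big1 => i _; rewrite !mxE eqxx; case: eqP => [->|]; rewrite ?addr0 //=.
    by case: eqP => [e|]; rewrite ?addr0 //; move: hj; rewrite e ltnn.
  apply/is_trig_mxP=> i k ik; rewrite !mxE -val_eqE /= (ltn_eqF ik) add0r.
  case: eqP => //= ij; case: eqP => //= kh.
  by move: ik; rewrite ij kh ltnNge ltnW.
have symS (a : {ffun 'I_(sumn [:: m]) -> 'I_n}) b (s : 'S_(sumn [:: m])) :
    S (wcat [ffun k => a (s k)] b) = S (wcat a b).
  rewrite !SE (reindex_inj (mulIg s^-1%g)) /=; apply: eq_bigr => t _.
  by congr (Qh (wcat _ _)); apply/ffunP=> k; rewrite !ffunE permM permKV.
have em : (nth 0%N lam h' < sumn [:: m])%N by rewrite /= addn0 me.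
have vanish := symmetric_vanish HF em wS uS symS.
have -> : Q = tact g Qh by rewrite /Qh tactM mulVmx // tact1.
rewrite contract_tact /x tact_symR.
pose al (k : 'I_(sumn [:: m])) (b : 'I_n) : F := \sum_a alpha k a * g^T a b.
rewrite (tact_dec g^T alpha) -[dec _]/(dec al).
suff -> : contract Qh (symR [:: m] (dec al)) = 0 by rewrite linear0.
apply/ffunP=> j; rewrite !ffunE.
transitivity (\sum_i S (wcat i j) * dec al i).
  under eq_bigr do rewrite symRE mulr_sumr.
  under [RHS]eq_bigr do rewrite SE mulr_suml.
  rewrite exchange_big /= [RHS]exchange_big /= [RHS](reindex_inj invg_inj) /=.
  rewrite (eq_bigl xpredT) => [|s]; last exact: symR_row.
  apply: eq_bigr => s _.
  rewrite [RHS](reindex (fun i : {ffun 'I_(sumn [:: m]) -> 'I_n} => [ffun k => i (s k)])) /=.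
    apply: eq_bigr => i _; congr (Qh (wcat _ _) * _); apply/ffunP=> k; by rewrite !ffunE permKV.
  exists (fun i : {ffun 'I_(sumn [:: m]) -> 'I_n} => [ffun k => i (s^-1%g k)]) => i _;
    by apply/ffunP=> k; rewrite !ffunE ?permK ?permKV.
apply: big1 => i _; have [/forallP hi|/forallPn[k]] := boolP [forall k, h <= i k]%N.
  by rewrite vanish ?mul0r.
rewrite -ltnNge => ik; rewrite [dec al i]ffunE (bigD1 k) //= (_ : al k (i k) = 0) ?mul0r ?mulr0 //.
rewrite /al -[RHS](Walpha k (i k) ik); apply: eq_bigr => a _; congr (_ * _).
have il := leq_trans ik hl; rewrite vg (vcoordE _ (Ordinal il)) !mxE.
rewrite (bigD1 (i k)) //= big1 ?addr0 => [|b bi]; first by rewrite !mxE eqxx mul1r.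
rewrite !mxE (_ : (b == i k :> nat) = false) ?mul0r //; exact/negbTE.
Qed.

End Generators.
End Polar.

(** * The Littlewood-Richardson tableau behind the Pieri product *)

Section StripTableau.
Local Open Scope nat_scope.

Lemma part_of_fun (g : nat -> nat) N : (forall i j, i <= j -> g j <= g i) -> g N = 0 ->
  exists s, [/\ is_part s, size s <= N & forall i, nth 0 s i = g i].
Proof.
move=> ganti gN; have ex : exists k, g k == 0 by exists N; apply/eqP.
case: (ex_minnP ex) => K /eqP gK minK; exists (mkseq g K); rewrite size_mkseq.
have nthE i : nth 0 (mkseq g K) i = g i.
  case: (ltnP i K) => iK; first by rewrite nth_mkseq.
  by rewrite nth_default ?size_mkseq //; apply/esym/eqP; rewrite -leqn0 -gK ganti.
split=> //; last by apply: minK; apply/eqP.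
apply/andP; split.
  apply/(sortedP 0) => i; rewrite size_mkseq => iK.
  by rewrite !nthE /geq /=; exact: ganti.
apply/allP=> x /(nthP 0)[i]; rewrite size_mkseq nthE => iK <-; rewrite lt0n.
by apply/negP=> /minK; rewrite leqNgt iK.
Qed.

(** The Yamanouchi condition of [LR_tableau], isolated so that the reading word can be built row by
    row. *)
Definition lattice (w : seq nat) :=
  forall k i, count_mem i.+2 (take k w) <= count_mem i.+1 (take k w).

Lemma lattice_nseq w c v : lattice w ->
  (forall v', v = v'.+2 -> count_mem v w + c <= count_mem v'.+1 w) ->
  lattice (w ++ nseq c v).
Proof.
move=> lw h k i; rewrite take_cat; case: ltnP => kw; first exact: lw.
have [t tc ->] : exists2 t, t <= c & take (k - size w) (nseq c v) = nseq t v.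
  exists (minn (k - size w) c); first exact: geq_minr.
  elim: c (k - size w)%N {h kw} => [|c IH] [|j] //=; rewrite ?minn0 ?min0n //.
  by rewrite minnSS /= IH.
have li := lw (size w) i; rewrite take_size in li.
rewrite !count_cat !count_nseq /=.
have [e|ne] := eqVneq v i.+2.
  rewrite e mul1n (_ : (i.+2 == i.+1) = false) ?mul0n ?addn0; last by rewrite gtn_eqF.
  by apply: leq_trans (h i e); rewrite e leq_add2l.
by rewrite mul0n addn0 (leq_trans li) ?leq_addr.
Qed.

Lemma count_mem_nseq (a c v : nat) : count_mem a (nseq c v) = if v == a then c else 0.
Proof. by rewrite count_nseq /=; case: eqP; rewrite ?mul1n ?mul0n. Qed.

Variables (lam : seq nat) (q : nat).
Hypotheses (plam : is_part lam) (qlam : nth 0 lam q.+1 < nth 0 lam q).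
Local Notation l i := (nth 0 lam i).
Local Notation m := (l q.+1).+1.

Definition strip_fun i := if i < q then l i else if i == q then (l q).-1 else l i.+1.

(** The right side is the number of letters [i.+1] in [strip_tableau]: they fill the boxes of row
    [i] from column [m] on and the boxes of row [i.+1] left of column [m]. *)
Lemma strip_funE i : strip_fun i = (l i - m) + minn m (l i.+1).
Proof.
rewrite /strip_fun; case: (ltngtP i q) => iq.
- have h1 : l q <= l i.+1 by apply: part_nth_anti.
  have h2 : l i.+1 <= l i by apply: part_nth_anti.
  lia.
- have h1 : l i <= l q.+1 by apply: part_nth_anti.
  have h2 : l i.+1 <= l i by apply: part_nth_anti.
  lia.
by rewrite iq; lia.
Qed.

(** Each column of the skew shape lambda/(m) is filled with 1, 2, 3, ... downwards: columns left of
    [m] start in row 1, the others in row 0. *)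
Definition strip_tableau r x := if x < m then r else r.+1.
Definition strip_row r := [seq strip_tableau r x |
  x <- rev (iota (nth 0 [:: m] r) (l r - nth 0 [:: m] r))].

Lemma map_const_in (s : seq nat) (f : nat -> nat) c :
  (forall x, x \in s -> f x = c) -> map f s = nseq (size s) c.
Proof.
elim: s => //= x s IH h; rewrite h ?mem_head // IH // => y ys.
by apply: h; rewrite inE ys orbT.
Qed.

Lemma strip_rowE r :
  strip_row r = nseq (l r - m) r.+1 ++ nseq (if r == 0 then 0 else minn m (l r)) r.
Proof.
rewrite /strip_row; case: r => [|r] /=.
  rewrite cats0 (@map_const_in _ _ 1) ?size_rev ?size_iota // => x.
  by rewrite mem_rev mem_iota /strip_tableau => /andP[mx _]; rewrite ltnNge mx.
rewrite nth_nil subn0.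
have -> : iota 0 (l r.+1) = iota 0 (minn m (l r.+1)) ++ iota (minn m (l r.+1)) (l r.+1 - m).
  by rewrite -[X in iota X (_ - _)]add0n -iotaD; congr iota; lia.
rewrite rev_cat map_cat; congr (_ ++ _).
  rewrite (@map_const_in _ _ r.+2) ?size_rev ?size_iota // => x.
  by rewrite mem_rev mem_iota /strip_tableau => h; case: ltnP => //; lia.
rewrite (@map_const_in _ _ r.+1) ?size_rev ?size_iota // => x.
by rewrite mem_rev mem_iota /strip_tableau => h; case: ltnP => //; lia.
Qed.

(** The letter counts are carried through the induction because [lattice_nseq] checks each new block
    against them. *)
Lemma strip_word_prefix r :
  let w := flatten [seq strip_row r' | r' <- iota 0 r] in
  lattice w /\ forall i, count_mem i.+1 w =
    (if i < r then l i - m else 0) + (if i.+1 < r then minn m (l i.+1) else 0).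
Proof.
elim: r => [|r [lw cw]]; first by split=> [k i|i].
rewrite -addn1 iotaD map_cat flatten_cat /= cats0 add0n strip_rowE catA.
set w := flatten _ in lw cw *; rewrite addn1.
have anti i : l i.+1 <= l i by apply: part_nth_anti.
have cw1 i : count_mem i.+1 (w ++ nseq (l r - m) r.+1) =
    (if i < r then l i - m else 0) + (if i.+1 < r then minn m (l i.+1) else 0)
    + (if r == i then l r - m else 0).
  by rewrite count_cat count_mem_nseq cw eqSS.
have lw1 : lattice (w ++ nseq (l r - m) r.+1).
  apply: lattice_nseq => // v' [rv]; rewrite !cw rv.
  by rewrite !ltnn ltnSn [v'.+2 < _]ltnNge leqnSn /= !add0n addn0 leq_sub2r // anti.
split.
  apply: lattice_nseq => // v' rv.
  have -> : count_mem r (w ++ nseq (l r - m) r.+1) =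
      count_mem v'.+2 (w ++ nseq (l r - m) r.+1) by rewrite [in pred1 r]rv.
  rewrite !cw1 rv.
  rewrite !ltnSn !ltnn (gtn_eqF (ltnSn v'.+1)) (gtn_eqF (ltnW (ltnSn v'.+1))) /= ltnS leqnSn.
  have := anti v'; have := anti v'.+1.
  by move: (l v'.+2) (l v'.+1) (l v') => x y z; lia.
move=> i; rewrite count_cat cw1 count_mem_nseq.
rewrite [i < r.+1]ltnS [i.+1 < r.+1]ltnS; case: (ltngtP i r) => ir.
- case: (ltngtP i.+1 r) => ir1; rewrite ?addn0 //.
    by move: ir; rewrite ltnNge -ltnS ir1.
  by rewrite -ir1.
- by rewrite [i.+1 < r]ltnNge (ltnW (leqW ir)) (ltn_eqF (leqW ir)).
by rewrite ir [r.+1 < r]ltnNge leqnSn (ltn_eqF (ltnSn r)) /= !addn0.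
Qed.

Lemma strip_LR b : (forall i, nth 0 b i = strip_fun i) -> LR_nonzero [:: m] b lam.
Proof.
move=> bE; have q_lt : q < size lam.
  by rewrite -part_nth_gt0 // (leq_ltn_trans (leq0n _) qlam).
have m_le : m <= l 0 by apply: leq_trans qlam _; apply: part_nth_anti.
split.
  split=> [|[|i]] /=; [exact: leq_ltn_trans (leq0n _) q_lt|exact: m_le|].
  by rewrite nth_nil.
exists strip_tableau; have [lw cw] := strip_word_prefix (size lam).
have defw : flatten [seq strip_row r | r <- iota 0 (size lam)] =
  flatten [seq [seq strip_tableau r x | x <- rev (iota (nth 0 [:: m] r) (l r - nth 0 [:: m] r))]
    | r <- iota 0 (size lam)] by [].
rewrite /LR_tableau -defw; split=> [r x|r x _ _|r x _ _|i|//].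
- by case: r => [|r] /andP[/= h1 _]; rewrite /strip_tableau; [rewrite [x < _]ltnNge h1|case: ifP].
- rewrite /strip_tableau; case: (ltnP x m) => [_|mx]; first by case: ifP.
  by rewrite [x.+1 < _]ltnNge (leqW mx).
- by rewrite /strip_tableau; case: ifP.
rewrite cw bE strip_funE; have := part_nth_gt0 i plam; have := part_nth_gt0 i.+1 plam.
by case: (ltnP i); case: (ltnP i.+1); lia.
Qed.

End StripTableau.

(** * From semi-invariant forms to apolarity *)

Section PolarPerp.
Context {F : fieldType} {n : nat}.
Local Notation gtensor K := {ffun {ffun K%type -> 'I_n} -> F^o}.
Variable lam : seq nat.
Hypothesis plam : is_part lam.
Variable p : gtensor 'I_(sumn lam).

Definition glue (A B : finType) (f : A -> B) (x : A + {b | b \notin codom f}) : B :=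
  match x with inl a => f a | inr b => val b end.

Lemma glue_bij (A B : finType) (f : A -> B) : injective f -> bijective (glue (f := f)).
Proof.
move=> fi; apply: inj_card_bij => [[x|x] [y|y] /= e|].
- by rewrite (fi _ _ e).
- by case/negP: (valP y); rewrite /= -e codom_f.
- by case/negP: (valP x); rewrite /= e codom_f.
- by rewrite (val_inj e).
by rewrite card_sum card_sig -(cardC (mem (codom f))) card_codom.
Qed.

(** [p] itself, with its slots split into the boxes of [mu] and the remaining ones, is a
    semi-invariant test; its contraction with [x] is the apolarity map up to the normalizing
    factor. *)
Lemma polar_perp mu (x : tensor (sumn mu)) : is_part mu -> polar p x ->
  subpart mu lam -> apolar lam mu p x = 0.
Proof.
move=> pmu [Sx Qx] [smu lemu].
have ex (k : 'I_(sumn mu)) : exists k' : 'I_(sumn lam), rowof lam k' = rowof mu k /\ colof lam k' = colof mu k.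
  by apply: box_exists => //; apply: leq_trans (lemu _); exact: colof_lt.
have /fin_all_exists[f fP] := ex.
have fi : injective f.
  by move=> k k' e; apply: (box_inj pmu); rewrite -?(fP k).1 -?(fP k).2 e ?(fP k').1 ?(fP k').2.
have [g fg gf] := glue_bij fi.
pose Q := reindex_tensor g p.
have sQ : semi_invariant p Q.
  by move=> gam chi dg hp; rewrite tact_reindex ?hp ?linearZ //; exists (glue (f := f)).
have cK : (#|{: {b | b \notin codom f}}| + sumn mu = sumn lam)%N.
  by rewrite -[RHS]card_ord -(bij_eq_card (glue_bij fi)) card_sum card_ord addnC.
have /ffunP cQ := Qx _ cK Q sQ.
apply/ffunP=> i; rewrite !ffunE.
pose j0 : {ffun {b | b \notin codom f} -> 'I_n} := [ffun b => i (val b)].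
suff -> : \sum_j x j * p (Defs.merge lam mu i j) = 0 by rewrite mulr0.
have := cQ j0; rewrite ffunE [RHS]ffunE => cz; rewrite -[RHS]cz; apply: eq_bigr => j _; rewrite mulrC ffunE.
congr (p _ * _); apply/ffunP=> k; rewrite !ffunE -{1 2 3 4}(gf k); case: (g k) => [a|b] /=.
  rewrite (fP a).1 (fP a).2 rowof_bound // offset_colof // valK /=.
  by [].
case: ifP => [rb|_]; last by rewrite ffunE.
case: insubP => [a _ ea|]; last by rewrite box_lt.
case/negP: (valP b); rewrite /= (_ : val b = f a) ?codom_f //.
by apply: (box_inj plam); rewrite ?(fP a).1 ?(fP a).2 -[a : nat]/(val a) ea ?rowof_box ?colof_box.
Qed.

End PolarPerp.

(** * A Pieri product *)

Section ExtendPerm.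
Variables (A B D : finType) (f : A + B -> D) (g : D -> A + B).
Hypotheses (fK : cancel f g) (gK : cancel g f).

Definition ext_fun (s : {perm B}) (x : D) : D :=
  f (match g x with inl a => inl a | inr b => inr (s b) end).

Lemma ext_fun_inj s : injective (ext_fun s).
Proof.
move=> x y /(can_inj fK); rewrite -[x]gK -[y]gK !fK.
by case: (g x) (g y) => [a|a] [b|b] // [] e; rewrite ?e // (perm_inj e).
Qed.

Definition ext_perm s : {perm D} := perm (@ext_fun_inj s).

Lemma ext_perml s a : ext_perm s (f (inl a)) = f (inl a).
Proof. by rewrite permE /ext_fun fK. Qed.
Lemma ext_permr s b : ext_perm s (f (inr b)) = f (inr (s b)).
Proof. by rewrite permE /ext_fun fK. Qed.

Lemma ext_permM s t : ext_perm (s * t)%g = (ext_perm s * ext_perm t)%g.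
Proof.
apply/permP=> x; rewrite -[x]gK permM; case: (g x) => y.
  by rewrite !ext_perml.
by rewrite !ext_permr permM.
Qed.

Lemma ext_perm1 : ext_perm 1 = 1%g.
Proof.
by apply/permP=> x; rewrite perm1 -[x]gK; case: (g x) => y; rewrite ?ext_perml ?ext_permr ?perm1.
Qed.

Lemma ext_tperm x y : ext_perm (tperm x y) = tperm (f (inr x)) (f (inr y)).
Proof.
have fI := can_inj fK.
apply/permP=> z; rewrite -[z]gK; case: (g z) => b.
  by rewrite ext_perml tpermD //; apply/eqP=> /fI.
rewrite ext_permr; case: tpermP => [->|->|/eqP bx /eqP by_]; rewrite ?tpermL ?tpermR //.
by rewrite tpermD //; apply/eqP=> /fI [e]; rewrite e eqxx in bx by_.
Qed.

(** A transposition extends to a transposition. This matches signs when the column group of a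
    smaller shape is embedded into that of lambda. *)
Lemma odd_ext_perm s : odd_perm (ext_perm s) = odd_perm s.
Proof.
have [ts -> _] := prod_tpermP s; elim: ts => [|[x y] ts IH].
  by rewrite big_nil ext_perm1 !odd_perm1.
rewrite big_cons ext_permM !odd_permM IH ext_tperm !odd_tperm.
by rewrite (inj_eq (can_inj fK)) (inj_eq _) //; move=> a b [].
Qed.

End ExtendPerm.

Section StripPlacement.
Variables (lam b : seq nat) (q c : nat).
Hypotheses (plam : is_part lam) (pb : is_part b).
Hypotheses (lec : (nth 0%N lam q.+1 <= c)%N) (ltc : (c < nth 0%N lam q)%N).
Hypothesis bE : forall i, nth 0%N b i = strip_fun lam q i.
Local Notation l i := (nth 0%N lam i).
Local Notation m := (l q.+1).+1.

Let c0 := (l q).-1.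
(** The removed box of row [q] is the last one, in column [c0]. Columns [c] and [c0] both have
    length [q.+1], so exchanging them moves the hole to column [c]. *)
Definition swap_col x := if x == c then c0 else if x == c0 then c else x.

Lemma swap_colK : involutive swap_col.
Proof.
move=> x; rewrite /swap_col; have [->|xc] := eqVneq x c.
  by rewrite eqxx; case: eqP.
by have [->|xc0] := eqVneq x c0; rewrite ?eqxx // (negbTE xc) (negbTE xc0).
Qed.

Lemma strip_box_lt r c' : (c' < nth 0 b r)%N -> (swap_col c' < l (bump q.+1 r))%N.
Proof.
have lq0 : (0 < l q)%N by exact: leq_ltn_trans ltc.
have c0l : (c0 < l q)%N by rewrite /c0 ltn_predL.
rewrite bE /strip_fun /bump /swap_col; case: (ltngtP r q) => rq h.
- rewrite add0n; have le := part_nth_anti plam (ltnW rq).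
  by case: eqP => _; [exact: leq_trans le|case: eqP => _ //; exact: leq_trans le].
- rewrite add1n; have h1 := leq_trans h (part_nth_anti plam (leqW rq : q.+1 <= r.+1)%N).
  have cc0 : (c <= c0)%N by rewrite /c0 -ltnS prednK.
  have h2 := leq_trans h1 lec.
  by rewrite (ltn_eqF h2) (ltn_eqF (leq_trans h2 cc0)).
rewrite rq add0n; case: eqP => _ //; case: eqP => _ //.
exact: leq_trans h (leq_pred _).
Qed.

(** The [m] slots of the one-row factor fill row [q.+1] and the single box in row [q], column [c],
    whence the extra 1 in [m]. The boxes of [b] fill the rest, whole columns going into columns. *)
Lemma strip_placement : exists f : 'I_(sumn [:: m]) + 'I_(sumn b) -> 'I_(sumn lam),
  [/\ bijective f,
      forall i, rowof lam (f (inl i)) = q.+1 \/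
                rowof lam (f (inl i)) = q /\ colof lam (f (inl i)) = c,
      forall k, rowof lam (f (inr k)) = bump q.+1 (rowof b k),
      forall k, colof lam (f (inr k)) = swap_col (colof b k) &
      forall k, rowof lam (f (inr k)) = q -> colof lam (f (inr k)) <> c].
Proof.
have ex (k : 'I_(sumn b)) : exists k' : 'I_(sumn lam),
    rowof lam k' = bump q.+1 (rowof b k) /\ colof lam k' = swap_col (colof b k).
  by apply: box_exists => //; apply: strip_box_lt; exact: colof_lt.
have /fin_all_exists[f fP] := ex.
have fi : injective f.
  move=> k k' e; apply: (box_inj pb).
    by apply: (can_inj (bumpK q.+1)); rewrite -(fP k).1 e (fP k').1.
  by apply: (can_inj swap_colK); rewrite -(fP k).2 e (fP k').2.
have fne k : rowof lam (f k) = q -> colof lam (f k) <> c.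
  rewrite (fP k).1 (fP k).2 => rq.
  have {}rq : rowof b k = q.
    move: rq; rewrite /bump; case: leqP => // h e.
    by move: (ltnW h); rewrite -e add1n ltnn.
  have := colof_lt pb (ltn_ord k); rewrite rq bE /strip_fun ltnn eqxx => h.
  move/(congr1 swap_col); rewrite swap_colK /swap_col eqxx => e.
  by rewrite e ltnn in h.
have LR : LR_nonzero [:: m] b lam by apply: strip_LR => //; exact: leq_ltn_trans ltc.
have cd := LR_sumn LR.
pose S := [set k : 'I_(sumn lam) | (rowof lam k == q.+1) || (rowof lam k == q) && (colof lam k == c)].
have cS : #|S| = sumn [:: m].
  have [k0 [rk0 ck0]] := box_exists plam ltc.
  have -> : S = k0 |: [set k : 'I_(sumn lam) | rowof lam k == q.+1].
    apply/setP=> k; rewrite !inE orbC; congr (_ || _); apply/andP/eqP => [[/eqP rk /eqP ck]|->].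
      by apply: (box_inj plam); rewrite ?rk0 ?ck0.
    by rewrite rk0 ck0 !eqxx.
  by rewrite cardsU1 inE rk0 card_row // ltn_eqF //= addn0.
have Scodom : S = ~: [set f k | k in 'I_(sumn b)].
  apply/eqP; rewrite eqEcard; apply/andP; split.
    apply/subsetP=> k; rewrite !inE => kS; apply/imsetP=> -[k' _ e]; move: kS.
    rewrite e; case/orP => [|/andP[/eqP h /eqP]]; last exact: fne.
    by rewrite (fP k').1 eq_sym (negbTE (neq_bump _ _)).
  by rewrite cardsCs setCK card_imset // !card_ord cS -cd addnK.
have [h hS hi] : exists2 h : 'I_(sumn [:: m]) -> 'I_(sumn lam), forall i, h i \in S & injective h.
  exists (fun i => enum_val (cast_ord (esym cS) i)) => [i|i j /enum_val_inj/cast_ord_inj //].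
  exact: enum_valP.
exists (fun x => match x with inl i => h i | inr k => f k end); split=> //.
- apply: inj_card_bij; last by rewrite card_sum !card_ord -cd.
  have hf i k : h i <> f k.
    by move=> e; have := hS i; rewrite e Scodom inE imset_f.
  move=> [x|x] [y|y] e.
  + by rewrite (hi _ _ e).
  + by case: (hf _ _ e).
  + by case: (hf _ _ (esym e)).
  by rewrite (fi _ _ e).
- move=> i; have := hS i; rewrite inE => /orP[/eqP|/andP[/eqP h1 /eqP h2]]; first by left.
  by right.
- by move=> k; rewrite (fP k).1.
by move=> k; rewrite (fP k).2.
Qed.

End StripPlacement.

(** * Derivatives of a functional along lines of decomposable tensors *)

Section Derivative.
Context {F : fieldType} {n : nat}.
Hypothesis HF : has_pchar0 F.
Implicit Types K : finType.
Local Notation gtensor K := {ffun {ffun K%type -> 'I_n} -> F^o}.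

(** The test points are the positive integers: infinitely many in characteristic 0, and invertible,
    as the rescaling in [frame_form_eq0] requires. *)
Lemma poly_nat_eq0 (P : {poly F}) : (forall t : nat, P.[t.+1%:R] = 0) -> P = 0.
Proof.
move=> Pt; apply/eqP; apply: contraT => P0.
pose s := [seq (t.+1%:R : F) | t <- iota 0 (size P)].
have su : uniq s.
  by rewrite map_inj_uniq ?iota_uniq // => a b /(natr_inj HF)[].
have := max_poly_roots P0 _ su; rewrite size_map size_iota ltnn; apply.
by apply/allP=> _ /mapP[t _ ->]; rewrite rootE Pt.
Qed.

Lemma deriv_prod (I : eqType) (r : seq I) (P : I -> {poly F}) : uniq r ->
  (\prod_(i <- r) P i)^`() = \sum_(i <- r) (P i)^`() * \prod_(j <- r | j != i) P j.
Proof.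
elim: r => [_|x r IH /= /andP[xr ur]]; first by rewrite !big_nil derivC.
rewrite !big_cons derivM IH // eqxx /=; congr (_ * _ + _).
  rewrite big_seq [RHS]big_seq_cond; apply: eq_bigl => j.
  by case: eqP => [->|_]; rewrite ?andbT // (negbTE xr).
rewrite mulr_sumr !big_seq; apply: eq_bigr => i ir; rewrite big_cons.
have -> : x != i by apply: contraNneq xr => ->.
by rewrite mulrCA.
Qed.

Definition line_poly (K : finType) (u : gtensor K) (y z : K -> 'I_n -> F) : {poly F} :=
  \sum_i (u i)%:P * \prod_k ((y k (i k))%:P + (z k (i k))%:P * 'X).

Lemma line_polyE K (u : gtensor K) y z t :
  (line_poly u y z).[t] = dot u (dec (fun k b => y k b + t * z k b)).
Proof.
rewrite /line_poly horner_sum; apply: eq_bigr => i _.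
rewrite hornerM hornerC horner_prod ffunE; congr (_ * _); apply: eq_bigr => k _.
by rewrite !hornerE mulrC.
Qed.

Definition replace (K : finType) (y : K -> 'I_n -> F) (k0 : K) (z : 'I_n -> F) k :=
  if k == k0 then z else y k.

Lemma deriv_line_poly K (u : gtensor K) y z t :
  (line_poly u y z)^`().[t] =
  \sum_k dot u (dec (replace (fun k b => y k b + t * z k b) k (z k))).
Proof.
rewrite /line_poly (linear_sum (@deriv F)) /= horner_sum exchange_big /=; apply: eq_bigr => i _.
rewrite derivM derivC mul0r add0r hornerM hornerC -mulr_sumr; congr (_ * _).
rewrite deriv_prod ?index_enum_uniq // horner_sum; apply: eq_bigr => k _.
rewrite [RHS]ffunE [RHS](bigD1 k) //= /replace eqxx hornerM; congr (_ * _).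
  by rewrite derivD derivC derivM derivC derivX mul0r !add0r mulr1 hornerC.
rewrite horner_prod; apply: eq_bigr => k' /negbTE ->.
by rewrite !hornerE mulrC.
Qed.

(** By the Leibniz rule the derivative is the sum of the one-slot replacements; a polynomial with
    zero derivative is constant in characteristic 0. *)
Lemma dot_line_const K (u : gtensor K) y z :
  (forall t k, dot u (dec (replace (fun k b => y k b + t * z k b) k (z k))) = 0) ->
  forall t, dot u (dec (fun k b => y k b + t * z k b)) = dot u (dec y).
Proof.
move=> h t; have d0 : (line_poly u y z)^`() = 0.
  by apply: poly_nat_eq0 => s; rewrite deriv_line_poly big1.
have -> : dot u (dec y) = (line_poly u y z).[0].
  by rewrite line_polyE; congr (dot u _); apply: eq_dec => k b; rewrite mul0r addr0.
rewrite -line_polyE; suff -> : line_poly u y z = ((line_poly u y z)`_0)%:P by rewrite !hornerC.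
apply/polyP=> -[|i]; rewrite coefC //=.
have := congr1 (fun P : {poly F} => P`_i) d0; rewrite coef_deriv coef0 -mulr_natr => /eqP.
by rewrite mulf_eq0 (proj1 (pcharf0P F) HF) orbF => /eqP.
Qed.

End Derivative.

(** * The annihilator of the ideal in degree lambda *)

Section StripVanish.
Context {F : fieldType} {n : nat}.
Hypothesis HF : has_pchar0 F.
Local Notation gtensor K := {ffun {ffun K%type -> 'I_n} -> F^o}.
Variable lam : seq nat.
Hypotheses (plam : is_part lam) (len : (size lam < n)%N).
Local Notation d := (sumn lam).
Local Notation R := (@symR F n lam).
Local Notation C := (@antiC F n lam).
Local Notation l i := (nth 0%N lam i).
Variable v : 'M[F]_(size lam, n).
Variable J : forall mu : seq nat, @tensor F n (sumn mu) -> Prop.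
Arguments J : clear implicits.
Hypotheses (Jgens : contains_gens lam v J) (Jmult : mult_closed J).
Variable u : gtensor 'I_d.
Hypothesis uJ : forall x : gtensor 'I_d, J lam x -> dot u x = 0.

(** The adjoint form of Young symmetrization: it evaluates [u] on arbitrary tensors after projecting
    them into the Schur module. *)
Definition young_adj : gtensor 'I_d := C (R (C u)).

Lemma dot_young_adj T : dot young_adj T = dot u (C (R (C T))).
Proof. by rewrite /young_adj dot_antiC dot_symR dot_antiC. Qed.

Lemma reindex_tens_permt (A : finType) (e : nat) (f : A + 'I_e -> 'I_d) g
  (fK : cancel f g) (gK : cancel g f) (s : 'S_e) (x : gtensor A) (y : gtensor 'I_e) :
  reindex_tensor f (tens x (permt e s y)) =
  permt d (ext_perm fK gK s) (reindex_tensor f (tens x y)).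
Proof.
apply/ffunP=> w; rewrite !ffunE; congr (x _ * y _); apply/ffunP=> k; rewrite !ffunE.
  by rewrite ext_perml.
by rewrite ext_permr.
Qed.

(** Since [f] sends columns into columns, the column group of [b] embeds into that of lambda with
    the same signs, and the outer antisymmetrization absorbs the inner one. *)
Lemma antiC_place (A : finType) (b : seq nat) (f : A + 'I_(sumn b) -> 'I_d) (sw : nat -> nat)
  (x : gtensor A) (U : gtensor 'I_(sumn b)) : bijective f ->
  (forall k, colof lam (f (inr k)) = sw (colof b k)) ->
  C (reindex_tensor f (tens x (antiC b U))) = ncols b *: C (reindex_tensor f (tens x U)).
Proof.
case=> g fK gK fcol.
pose Phi (z : gtensor 'I_(sumn b)) : gtensor 'I_d := C (reindex_tensor f (tens x z)).
have Philin t z z' : Phi (t *: z + z') = t *: Phi z + Phi z'.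
  by rewrite /Phi (linearP (tens x)) /= (linearP (reindex_tensor f)) /= (linearP C).
rewrite antiC_def -[LHS]/(Phi _) (linear_comb _ _ _ Philin).
rewrite (eq_bigr (fun=> Phi U)) => [|s /colstabP cs].
  by rewrite sumr_const /ncols scaler_nat; congr (_ *+ _); apply: eq_card.
rewrite /Phi (reindex_tens_permt fK gK) antiC_permt.
  by rewrite odd_ext_perm scalerA -signr_addb addbb scale1r.
apply/colstabP=> k; rewrite -[k]gK; case: (g k) => k'; first by rewrite ext_perml.
by rewrite ext_permr !fcol cs.
Qed.

(** The tensor is, up to a nonzero scalar and Young symmetrization, the product of the m-th power of
    [y q.+1] with the rank one tensor of shape [b] on the other vectors, both placed by
    [strip_placement]. *)
Lemma strip_vanish (q c : nat) (y : nat -> 'I_n -> F) :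
  (l q.+1 <= c)%N -> (c < l q)%N -> in_Wperp lam v q.+1 (y q.+1) ->
  dot young_adj (dec (fun k : 'I_d =>
     if (rowof lam k == q) && (colof lam k == c) then y q.+1 else y (rowof lam k))) = 0.
Proof.
move=> lec ltc Wy; have qlam : (l q.+1 < l q)%N by exact: leq_ltn_trans ltc.
set m := (l q.+1).+1.
have [i j ij||b [pb sb bE]] := @part_of_fun (strip_fun lam q) (size lam).
- rewrite !strip_funE //; apply: leq_add; first by rewrite leq_sub2r // part_nth_anti.
  by rewrite leq_min geq_minl (leq_trans (geq_minr _ _)) // part_nth_anti.
- rewrite strip_funE // (nth_default 0%N (leqnn (size lam))).
  by rewrite (nth_default 0%N (leqnSn (size lam))) minn0 sub0n.
have [f [fb fl fr fc fne]] := strip_placement plam pb lec ltc bE.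
pose M (x : gtensor 'I_(sumn [:: m])) (z : gtensor 'I_(sumn b)) : gtensor 'I_d :=
  C (R (C (reindex_tensor f (tens x z)))).
have MM : mult_map [:: m] b lam (M : @tensor F n _ -> @tensor F n _ -> @tensor F n _).
  split=> [x z _ _|t x x' z _ _ _|t x z z' _ _ _|g _ x z _ _].
  - by exists (C (reindex_tensor f (tens x z))).
  - by rewrite /M tens_linearl (linearP (reindex_tensor f)) /= (linearP C) /= (linearP R) /= (linearP C).
  - by rewrite /M (linearP (tens x)) /= (linearP (reindex_tensor f)) /= (linearP C) /= (linearP R) /= (linearP C).
  by rewrite !actDE /M tact_antiC tact_symR tact_antiC tact_reindex // tact_tens.
pose al (_ : 'I_(sumn [:: m])) := y q.+1.
pose z := fun k : 'I_(sumn b) => y (bump q.+1 (rowof b k)).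
(* The bounds on [c] say that its column has length exactly [q.+1], so the generators attached to it
   are those of W_(q+1), of degree [m]. *)
have Jx : J [:: m] (symR [:: m] (dec al)).
  have cc : (c < size (Defs.conj lam))%N.
    by rewrite size_conj -nth0 (leq_trans ltc) // part_nth_anti.
  have hE : nth 0%N (Defs.conj lam) c = q.+1.
    by apply/eqP; rewrite eqn_leq ltn_conj // ltc andbT leqNgt ltn_conj // -leqNgt.
  have := Jgens cc; rewrite /= hE (count_conj _ plam); apply.
  by move=> k.
have Sz : SchurMod b (antiC b (dec z)).
  pose vz : 'M[F]_(size b, n) := \matrix_(r, a) y (bump q.+1 r) a.
  have -> : antiC b (dec z) = rank1 b vz.
    rewrite rank1E //; congr (antiC b _); apply: eq_dec => k a.
    by rewrite (vcoordE _ (Ordinal (rowof_lt_size k pb))) mxE.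
  exact: SchurMod_rank1.
have vm : @validp n [:: m].
  rewrite /validp /is_part /=; apply: leq_ltn_trans len.
  by rewrite -part_nth_gt0 //; apply: leq_ltn_trans (leq_trans ltc (part_nth_anti plam (leq0n q))).
have vb : @validp n b by rewrite /validp pb (leq_ltn_trans sb).
have vl : @validp n lam by rewrite /validp plam.
have := uJ (Jmult vm vb vl (strip_LR plam qlam bE) MM Jx Sz).
rewrite /M (antiC_place _ _ fb fc).
have -> : symR [:: m] (dec al) = nrows [:: m] *: dec al.
  apply: symR_id => s _; apply/ffunP=> i; rewrite !ffunE [RHS](reindex_inj (@perm_inj _ s)) /=.
  by apply: eq_bigr => k _; rewrite ffunE.
rewrite -[_ *: dec al]addr0 tens_linearl.
have -> : tens 0 (dec z) = 0 :> gtensor ('I_(sumn [:: m]) + 'I_(sumn b)).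
  by apply/ffunP=> w; rewrite !ffunE mul0r.
rewrite addr0 !linearZ /= -dot_young_adj => /eqP.
rewrite !mulf_eq0 (negbTE (ncols_neq0 _ HF)) (negbTE (nrows_neq0 _ HF)) /= => /eqP.
have [g fK gK] := fb.
rewrite tens_dec (reindex_dec _ fK gK) => <-; congr (dot _ _); apply: eq_dec => k a.
rewrite -{1 2 3}[k]gK; case: (g k) => k' /=.
  case: (fl k') => [->|[-> ->]]; last by rewrite !eqxx.
  by rewrite (gtn_eqF (ltnSn q)).
case: ifP => [/andP[/eqP rk /eqP ck]|_]; first by case: (fne _ rk).
by rewrite fr.
Qed.

Lemma antiC_repeat (y : 'I_d -> 'I_n -> F) (k k' : 'I_d) : k != k' -> colof lam k = colof lam k' ->
  y k =1 y k' -> C (dec y) = 0.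
Proof.
move=> kk ck yk; have st : colstab lam (tperm k k').
  by apply/colstabP=> x; case: tpermP => // ->.
have e : permt d (tperm k k') (dec y) = dec y.
  apply/ffunP=> i; rewrite !ffunE [RHS](reindex_inj (@perm_inj _ (tperm k k'))) /=.
  by apply: eq_bigr => x _; rewrite ffunE; case: tpermP => // ->; rewrite yk.
have := antiC_permt (dec y) st; rewrite e odd_tperm kk expr1 scaleN1r => /eqP.
rewrite -subr_eq0 opprK -mulr2n -scaler_nat scaler_eq0.
by rewrite (proj1 (pcharf0P F) HF) => /eqP.
Qed.

(** A box of row [q] whose column reaches row [q.+1] contributes zero, the same vector then
    occurring twice in that column; any other box is covered by [strip_vanish]. Row [q.+1] does not
    move along the line, so the hypothesis persists for every t. *)
Lemma row_add (q : nat) (y : nat -> 'I_n -> F) (t : F) :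
  in_Wperp lam v q.+1 (y q.+1) ->
  dot young_adj (dec (fun k : 'I_d => fun b =>
     y (rowof lam k) b + t * (if rowof lam k == q then y q.+1 b else 0))) =
  dot young_adj (dec (fun k : 'I_d => y (rowof lam k))).
Proof.
move=> Wy; apply: (dot_line_const HF (y := fun k : 'I_d => y (rowof lam k))
  (z := fun (k : 'I_d) b => if rowof lam k == q then y q.+1 b else 0)) => {}t k.
have [rk|rk] := eqVneq (rowof lam k) q; last first.
  rewrite /dot big1 // => i _; rewrite ffunE (bigD1 k) //= /replace eqxx mul0r mulr0 //.
pose yt r b := y r b + t * (if r == q then y q.+1 b else 0).
have ytq : yt q.+1 =1 y q.+1 by move=> b; rewrite /yt (gtn_eqF (ltnSn q)) mulr0 addr0.
have [kc|kc] := leqP (l q.+1) (colof lam k).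
  have kl : (colof lam k < l q)%N by rewrite -rk colof_lt.
  have Wyt : in_Wperp lam v q.+1 (yt q.+1).
    by move=> r rq; rewrite -[RHS](Wy r rq); apply: eq_bigr => b _; rewrite ytq.
  rewrite -[RHS](strip_vanish kc kl Wyt); congr (dot _ _); apply: eq_dec => k' b.
  rewrite /replace; have [->|kk] := eqVneq k' k; first by rewrite rk !eqxx /= ytq.
  rewrite [_ && _](_ : _ = false) //; apply/negbTE/negP=> /andP[/eqP rk' /eqP ck'].
  case/eqP: kk.
  by apply: (box_inj plam); rewrite ?rk' ?rk ?ck'.
have [k1 [rk1 ck1]] := box_exists plam kc.
rewrite dot_young_adj (@antiC_repeat _ k k1) ?(linear0 R) ?(linear0 C) ?linear0 //.
- by apply/eqP=> e; move: rk1; rewrite -e rk => /n_Sn.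
have kk1 : k1 != k by apply/eqP=> e; move: rk1; rewrite e rk => /n_Sn.
move=> b; rewrite /replace eqxx (negbTE kk1) rk1 (gtn_eqF (ltnSn q)).
by rewrite mulr0 addr0.
Qed.

Variable g : 'M[F]_n.
Hypotheses (ug : g \in unitmx) (vg : v = std_frame lam *m g).
Local Notation E := (@std_frame F n lam).
Local Notation gd := (invmx g)^T.

(** The rows of [gd] are the basis dual to the rows of [g]; the first rows of [U] are coordinates in
    it, and [U = 1%:M] gives the dual highest weight vector. *)
Definition frame_form (U : 'M[F]_n) : F := dot u (rank1 lam (E *m U *m gd)).

Lemma frame_form_lower (L U : 'M[F]_n) (delta : nat -> F) :
  (forall i j : 'I_n, (i < j)%N -> L i j = 0) -> (forall i : 'I_n, L i i = delta i) ->
  frame_form (L *m U) =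
  (\prod_(c < size (Defs.conj lam)) \prod_(r < nth 0%N (Defs.conj lam) c) delta r) * frame_form U.
Proof.
move=> Ll Ld; rewrite /frame_form mulmxA (std_frame_lower (ltnW len)) // -!mulmxA.
rewrite (rank1_lower plam (delta := delta)) ?linearZ // => [i j ij|i]; rewrite mxE; [exact: Ll|exact: Ld].
Qed.

Lemma frame_form_young (w : 'M[F]_(size lam, n)) :
  dot young_adj (dec (fun k : 'I_d => vcoord w (rowof lam k))) =
  kappa plam (ltnW len) * dot u (rank1 lam w).
Proof.
rewrite dot_young_adj -rank1E // (young_kappa HF plam (ltnW len)) ?linearZ //.
exact: SchurMod_rank1.
Qed.

(** Interpolates between upper unitriangular matrices ([k = n]) and all matrices ([k = 0]). *)
Definition unitri (k : nat) (U : 'M[F]_n) :=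
  forall a b : 'I_n, (a < k)%N -> (b <= a)%N -> U a b = (b == a)%:R.

Definition add_row (U : 'M[F]_n) (i j : 'I_n) (t : F) : 'M[F]_n :=
  \matrix_(a, b) (U a b + (if a == i then t * U j b else 0)).
Definition set_row (U : 'M[F]_n) (j : 'I_n) (w : 'I_n -> F) : 'M[F]_n :=
  \matrix_(a, b) (if a == j then w b else U a b).

(** Row i+1 of a unitriangular [U] involves only dual basis vectors from i+1 on, hence annihilates
    W_(i+1), as [row_add] asks. *)
Lemma frame_form_add (U : 'M[F]_n) (i j : 'I_n) (t : F) : unitri n U -> j = i.+1 :> nat ->
  frame_form (add_row U i j t) = frame_form U.
Proof.
move=> uU ji; apply: (mulfI (kappa_neq0 HF plam (ltnW len))).
rewrite -!frame_form_young.
pose y r := vcoord (U *m gd) r.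
have Wy : in_Wperp lam v i.+1 (y i.+1).
  move=> r ri; have rn : (r < n)%N by apply: leq_ltn_trans (ltn_ord i); rewrite -ltnS.
  have [rl|lr] := ltnP r (size lam); last first.
    by apply: big1 => b _; rewrite [vcoord v _ _]vcoord_over ?mulr0.
  transitivity ((U *m gd *m g^T) j (Ordinal rn)).
    rewrite [RHS]mxE; apply: eq_bigr => b _; rewrite /y -ji (vcoordE _ j) [g^T _ _]mxE.
    by rewrite vg (vcoord_std (ltnW len)) // (vcoordE _ (Ordinal rn)).
  rewrite -mulmxA -trmx_mul mulmxV // trmx1 mulmx1 uU //=; last by rewrite ji ltnW.
  by rewrite -val_eqE /= (ltn_eqF _) // ji.
transitivity (dot young_adj (dec (fun k : 'I_d => y (rowof lam k)))); last first.
  by congr (dot _ _); apply: eq_dec => k b; rewrite -mulmxA (vcoord_std (ltnW len)) // rowof_lt_size.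
rewrite -(row_add t Wy); congr (dot _ _); apply: eq_dec => k b.
have rl := rowof_lt_size k plam; have rn := leq_trans rl (ltnW len).
rewrite -mulmxA (vcoord_std (ltnW len)) // /y -ji !(vcoordE _ (Ordinal rn)) (vcoordE _ j) !mxE.
under eq_bigr do rewrite mxE mulrDl.
rewrite big_split /=; congr (_ + _); rewrite -val_eqE /=; case: eqP => _.
  by rewrite mulr_sumr; apply: eq_bigr => a _; rewrite mulrA.
by rewrite mulr0 big1 // => a _; rewrite mul0r.
Qed.

Lemma unitri_add (U : 'M[F]_n) (i j : 'I_n) (t : F) : unitri n U -> (i < j)%N ->
  unitri n (add_row U i j t).
Proof.
move=> uU ij a b an ba; rewrite mxE uU //; case: (a =P i) => [e|_]; last by rewrite addr0.
rewrite uU // ?(leq_trans ba) // e ?(ltnW ij) //.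
rewrite [b == j](_ : _ = false) ?mulr0 ?addr0 //.
by apply/negbTE; rewrite -val_eqE /= neq_ltn (leq_ltn_trans ba) // e.
Qed.

(* To change row i by w = w_j e_j + w', where j = i + 1: replace row j by
   e_j + w', add it to row i, reset row j to e_j, and add (w_j - 1) e_j to row i. *)
Lemma frame_form_unitri (m : nat) (U U' : 'M[F]_n) : unitri n U -> unitri n U' ->
  (forall a b : 'I_n, (a + m < n)%N -> U a b = U' a b) -> frame_form U = frame_form U'.
Proof.
elim: m U U' => [|m IH] U U' uU uU' UU'.
  by congr frame_form; apply/matrixP=> a b; rewrite UU' // addn0.
have [nm|mn] := leqP n m.
  by apply: IH => // a b; rewrite ltnNge (leq_trans nm) ?leq_addl.
(* The last row of a unitriangular matrix is determined, so this step is free. *)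
have [m0|m0] := posnP m.
  apply: IH => // a b _; have [ab|ba] := leqP b a; first by rewrite uU ?uU'.
  by apply: UU'; rewrite m0 addn1; apply: leq_ltn_trans (ltn_ord b).
have jn : (n - m < n)%N by rewrite ltn_subrL m0 (leq_trans _ mn).
have in_ : ((n - m).-1 < n)%N by exact: leq_ltn_trans (leq_pred _) jn.
(* [U] and [U'] agree above row [i]; the induction hypothesis allows free changes in the rows from
   [j] on. *)
pose i := Ordinal in_; pose j := Ordinal jn.
have ji : j = i.+1 :> nat by rewrite /= prednK // subn_gt0.
have ij : (i < j)%N by rewrite ji.
have row_lt (a : 'I_n) : (a + m < n)%N -> (a < j)%N by rewrite /= ltn_subRL addnC.
pose w b := U' i b - U i b.
have w0 (b : 'I_n) : (b <= i)%N -> w b = 0 by move=> bi; rewrite /w uU ?uU' // subrr.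
pose V1 := set_row U j (fun b => if (b <= j)%N then (b == j)%:R else w b).
have uV1 : unitri n V1.
  move=> a b an ba; rewrite mxE; case: (a =P j) => [e|_]; last exact: uU.
  by rewrite e in ba *; rewrite ba.
pose V2 := add_row V1 i j 1.
pose V3 := set_row V2 j (fun b => (b == j)%:R).
pose V4 := add_row V3 i j (w j - 1).
have uV2 : unitri n V2 by exact: unitri_add.
have uV3 : unitri n V3.
  move=> a b an ba; rewrite mxE; case: (a =P j) => [->//|_]; exact: uV2.
have uV4 : unitri n V4 by exact: unitri_add.
have neqj (a : 'I_n) : (a < j)%N -> (a == j) = false.
  by move=> aj; apply/negbTE; rewrite -val_eqE neq_ltn aj.
rewrite -(IH V1 U) //; last by move=> a b /row_lt/neqj aj; rewrite mxE aj.
rewrite -(frame_form_add 1 uV1 ji) -/V2.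
rewrite -(IH V3 V2) //; last by move=> a b /row_lt/neqj aj; rewrite mxE aj.
rewrite -(frame_form_add (w j - 1) uV3 ji) -/V4; apply: IH => // a b /row_lt aj.
rewrite [V4 a b]mxE [V3 a b]mxE [V3 j b]mxE eqxx (neqj a aj) [V2 a b]mxE [V1 a b]mxE [V1 j b]mxE eqxx (neqj a aj).
have [ai|ai] := eqVneq a i; last first.
  rewrite !addr0; apply: UU'; have : (a < i)%N.
    by rewrite ltn_neqAle -ltnS -ji aj andbT; apply: contra ai => /eqP e; apply/eqP/val_inj.
  rewrite /= => ai'; rewrite addnS -addSn; 
  by have := row_lt; move: ai'; rewrite -ltnS prednK ?subn_gt0 // !ltn_subRL; lia.
rewrite ai; case: (ltngtP b j) => bj.
- have bi : (b <= i)%N by rewrite -ltnS -ji.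
  by rewrite (neqj _ bj) !mulr0 !addr0 uU ?uU'.
- rewrite [b == j](_ : _ = false) ?mulr0 ?addr0 ?mul1r; first by rewrite /w addrC subrK.
  by apply/negbTE; rewrite -val_eqE neq_ltn bj orbT.
have -> : b = j by apply: val_inj.
by rewrite eqxx !mulr1 -addrA [1 + _]addrC subrK /w addrC subrK.
Qed.

Lemma frame_form_eq0_unitri U : frame_form 1%:M = 0 -> unitri n U -> frame_form U = 0.
Proof.
move=> f1 uU; rewrite -f1; apply: (frame_form_unitri (m := n)) => // [a b _ _|a b].
  by rewrite mxE eq_sym.
by rewrite ltnNge leq_addl.
Qed.

Lemma frame_form_line (A B : 'M[F]_n) :
  exists P : {poly F}, forall t, frame_form (A + t *: B) = P.[t].
Proof.
exists (line_poly (C u) (fun k : 'I_d => vcoord (E *m A *m gd) (rowof lam k))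
  (fun k : 'I_d => vcoord (E *m B *m gd) (rowof lam k))) => t.
rewrite line_polyE /frame_form rank1E // dot_antiC; congr (dot u (C _)).
apply: eq_dec => k b; have rl := rowof_lt_size k plam.
rewrite -!mulmxA !(vcoord_std (ltnW len)) // !(vcoordE _ (Ordinal (leq_trans rl (ltnW len)))).
by rewrite mulmxDl -scalemxAl !mxE.
Qed.

(** Lower triangular row operations only rescale the form, so elimination reduces to the
    unitriangular case. Row [k] is cleared left of the diagonal, then its diagonal entry is
    normalized; a zero pivot is reached by polynomial continuation. *)
Lemma frame_form_eq0 U : frame_form 1%:M = 0 -> frame_form U = 0.
Proof.
move=> f1; suff: forall k, (k <= n)%N -> forall U, unitri k U -> frame_form U = 0.
  by move/(_ 0%N isT U); apply=> a b.
move=> k; move em : (n - k)%N => m; elim: m k em {U} => [|m IH] k em kn U uk.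
  by apply: frame_form_eq0_unitri => //; rewrite (_ : n = k) //; apply/eqP; rewrite eqn_leq kn -subn_eq0 em.
have kn' : (k < n)%N by rewrite -subn_gt0 em.
have {}IH := IH k.+1 _ kn'; rewrite subnS em /= in IH; have {}IH := IH erefl.
pose ko := Ordinal kn'.
suff: forall s, (s <= k)%N -> forall U, unitri k U ->
    (forall b : 'I_n, (b < s)%N -> U ko b = 0) -> frame_form U = 0.
  by move/(_ 0%N isT U uk); apply.
move=> s; move er : (k - s)%N => r; elim: r s er {U uk} => [|r IHr] s er sk U uk Us.
  have {er sk} es : s = k by apply/eqP; rewrite eqn_leq sk -subn_eq0 er.
  (* The diagonal entry becomes a variable t. For a positive integer t, dividing row [k] by t gives
     a matrix covered by the induction, so the polynomial in t vanishes identically, including at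
     [U ko ko]. *)
  pose A := U - U ko ko *: delta_mx ko ko.
  have AE (t : F) a b : (A + t *: delta_mx ko ko) a b =
      if a == ko then (if b == ko then t else U a b) else U a b.
    rewrite !mxE; case: eqP => [->|_]; rewrite /= ?mulr0 ?subr0 ?addr0 //.
    by case: eqP => [->|_]; rewrite /= ?mulr1 ?subrr ?add0r ?mulr0 ?subr0 ?addr0.
  have [P PE] := frame_form_line A (delta_mx ko ko).
  have P0 : P = 0.
    apply: (poly_nat_eq0 HF) => t; rewrite -PE.
    have t0 : (t.+1%:R : F) != 0 by rewrite (proj1 (pcharf0P F) HF).
    pose delta a : F := if a == k then t.+1%:R else 1.
    pose U1 := set_row U ko (fun b => if b == ko then 1 else t.+1%:R^-1 * U ko b).
    have -> : A + t.+1%:R *: delta_mx ko ko = diag_mx (\row_a delta a) *m U1.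
      apply/matrixP=> a b; rewrite AE mul_diag_mx !mxE /delta -[a == ko]val_eqE /=.
      case: eqP => [e|_]; last by rewrite mul1r.
      have -> : a = ko by apply: val_inj.
      by case: (b == ko); rewrite ?mulr1 // mulrA mulfV // mul1r.
    rewrite (@frame_form_lower _ _ delta) => [|i j ij|i].
    - rewrite IH ?mulr0 // => a b ak ba; rewrite mxE; have [e|ne] := eqVneq a ko.
        rewrite e in ba *; case: eqP => // /eqP bk.
        by rewrite Us ?mulr0 // es ltn_neqAle ba andbT.
      rewrite uk // ltn_neqAle -ltnS ak andbT.
      by apply: contra ne => /eqP e; apply/eqP/val_inj.
    - by rewrite !mxE -val_eqE /= (ltn_eqF ij) mulr0n.
    by rewrite !mxE eqxx mulr1n.
  have -> : U = A + U ko ko *: delta_mx ko ko by rewrite subrK.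
  by rewrite PE P0 horner0.
have sk' : (s < k)%N by rewrite -subn_gt0 er.
pose so := Ordinal (ltn_trans sk' kn').
(* Row [s] has 1 on the diagonal and zeros to its left, so subtracting this multiple clears entry
   [s] of row [k] and keeps the earlier zeros. *)
pose L : 'M[F]_n := 1%:M - U ko so *: delta_mx ko so.
have LUE a b : (L *m U) a b = U a b - (if a == ko then U ko so * U so b else 0).
  rewrite mulmxBl mul1mx -scalemxAl !mxE; congr (_ - _).
  case: (a =P ko) => [->|/eqP ak]; last first.
    by rewrite big1 ?mulr0 // => c _; rewrite !mxE (negbTE ak) mul0r.
  congr (_ * _); rewrite (bigD1 so) //= !mxE !eqxx mul1r big1 ?addr0 // => c cs.
  by rewrite !mxE (negbTE cs) andbF mul0r.
have <- : frame_form (L *m U) = frame_form U.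
  rewrite (@frame_form_lower _ _ (fun=> 1)) => [|i j ij|i].
  - by rewrite big1 ?mul1r // => c _; rewrite big1.
  - rewrite !mxE -val_eqE /= (ltn_eqF ij) sub0r; case: eqP => //= [ik|]; last by rewrite mulr0 oppr0.
    case: eqP => //= [js|]; last by rewrite mulr0 oppr0.
    by move: ij; rewrite ik js ltnNge ltnW.
  rewrite !mxE eqxx; case: eqP => //= [->|]; last by rewrite mulr0 subr0.
  rewrite -val_eqE /= (gtn_eqF sk') mulr0 subr0 //.
apply: (IHr s.+1) => // [|a b ak ba|b bs]; first by rewrite subnS er.
  rewrite LUE; case: (a =P ko) => [e|_]; last by rewrite subr0 uk.
  by move: ak; rewrite e /= ltnn.
rewrite LUE eqxx (uk so b) //; have [bs'|sb] := ltnP b s.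
  by rewrite Us // -val_eqE /= (ltn_eqF bs') mulr0 subr0.
have -> : b = so by apply: val_inj; apply/eqP; rewrite eqn_leq sb andbT -ltnS.
by rewrite eqxx mulr1 subrr.
Qed.

Lemma annihilator_eq0 : frame_form 1%:M = 0 -> forall z, SchurMod lam z -> dot u z = 0.
Proof.
move=> f1 z; apply: (Schur_ind plam (P := fun z => dot u z = 0)).
- by rewrite linear0.
- by move=> t x y hx hy; rewrite (linearP (dot u)) /= hx hy scaler0 addr0.
move=> w; have EE : E *m E^T = 1%:M := std_frameK (ltnW len).
rewrite -(frame_form_eq0 (E^T *m w *m g^T) f1) /frame_form.
by rewrite !mulmxA EE mul1mx -mulmxA -trmx_mul mulVmx // trmx1 mulmx1.
Qed.

End StripVanish.

(** * Duality *)

Section Duality.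
Context {F : fieldType} {n : nat}.
Implicit Types K : finType.
Local Notation gtensor K := {ffun {ffun K%type -> 'I_n} -> F^o}.

(** The subspace is an undecided predicate. Excluded middle either yields a vector outside the
    current row space, which raises the rank, or ends the search; [k] bounds the rank still
    available. *)
Lemma subspace_matrix N (I : 'rV[F]_N -> Prop) : I 0 ->
  (forall t x y, I x -> I y -> I (t *: x + y)) ->
  exists A : 'M[F]_N, forall x, I x <-> (x <= A)%MS.
Proof.
move=> I0 Ilin.
suff grow k (A : 'M[F]_N) : (N - \rank A <= k)%N -> (forall x : 'rV_N, (x <= A)%MS -> I x) ->
    exists A' : 'M[F]_N, forall x, I x <-> (x <= A')%MS.
  apply: (grow N 0); first exact: leq_subr.
  by move=> x; rewrite submx0 => /eqP->.
elim: k A => [|k IH] A rA sA.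
  exists A => x; split=> [_|]; last exact: sA.
  apply: submx_full; rewrite /row_full eqn_leq rank_leq_col /=.
  by rewrite -subn_eq0 -leqn0.
have [[x [Ix nx]]|none] := classic (exists x, I x /\ ~ (x <= A)%MS); last first.
  exists A => x; split=> [Ix|]; last exact: sA.
  by have [//|nx] := boolP (x <= A)%MS; case: none; exists x; split=> //; apply/negP.
apply: (IH (A + x)%MS).
  have : (\rank A < \rank (A + x)%MS)%N.
    rewrite ltn_neqAle mxrankS ?addsmxSl // andbT; apply/negP=> /eqP e; apply: nx.
    have := mxrank_leqif_eq (addsmxSl A x) => -[_]; rewrite e eqxx => /esym/andP[_ h].
    exact: submx_trans (addsmxSr A x) h.
  by move=> h; rewrite -ltnS (leq_trans _ rA) // ltn_sub2l // (leq_trans h) // rank_leq_col.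
move=> z /sub_addsmxP[[a b] /= ->].
rewrite -[a *m A]scale1r; apply: (Ilin); first by apply: sA; exact: submxMl.
by rewrite [b]mx11_scalar mul_scalar_mx -[_ *: x]addr0; apply: (Ilin).
Qed.

Definition vec K (T : gtensor K) : 'rV[F]_#|{ffun K -> 'I_n}| := \row_k T (enum_val k).
Definition unvec K (x : 'rV[F]_#|{ffun K -> 'I_n}|) : gtensor K :=
  [ffun w : {ffun K -> 'I_n} => (x 0 (enum_rank w) : F^o)].

Lemma vecK K : cancel (@vec K) (@unvec K).
Proof. by move=> T; apply/ffunP=> w; rewrite ffunE mxE enum_rankK. Qed.

Lemma unvecK K : cancel (@unvec K) (@vec K).
Proof. by move=> x; apply/rowP=> k; rewrite mxE ffunE enum_valK. Qed.

Lemma unvec_lin K t (x y : 'rV[F]_#|{ffun K -> 'I_n}|) :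
  unvec (t *: x + y) = t *: unvec x + unvec y.
Proof. by apply/ffunP=> w; rewrite !ffunE !mxE. Qed.

Lemma dot_vec K (u T : gtensor K) : dot u T = (vec T *m (vec u)^T) 0 0.
Proof.
rewrite mxE /dot (reindex (fun k : 'I_#|{ffun K -> 'I_n}| => enum_val k)) /=; last first.
  by exists enum_rank => x _; [exact: enum_valK|exact: enum_rankK].
by apply: eq_bigr => k _; rewrite !mxE mulrC.
Qed.

(* Sub-row-spaces are cut out by the columns of cokermx. *)
Lemma separate K N (A : 'M[F]_(N, #|{ffun K -> 'I_n}|)) (T : gtensor K) : ~~ (vec T <= A)%MS ->
  exists2 u : gtensor K, (forall z, (vec z <= A)%MS -> dot u z = 0) & dot u T != 0.
Proof.
rewrite submxE => /matrix0Pn[i [j nz]]; rewrite ord1 in nz.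
exists (unvec (col j (cokermx A))^T) => [z|].
  rewrite submxE dot_vec unvecK trmxK colE mulmxA => /eqP->.
  by rewrite mul0mx mxE.
by rewrite dot_vec unvecK trmxK colE mulmxA -colE mxE.
Qed.

Lemma separate_subspace K (I : gtensor K -> Prop) (T : gtensor K) : I 0 ->
  (forall t x y, I x -> I y -> I (t *: x + y)) -> ~ I T ->
  exists2 u : gtensor K, (forall z, I z -> dot u z = 0) & dot u T != 0.
Proof.
move=> I0 Ilin nT; have [||A AP] := @subspace_matrix _ (fun x => I (unvec x)).
- by rewrite (_ : unvec 0 = 0) //; apply/ffunP=> w; rewrite !ffunE mxE.
- by move=> t x y Ix Iy; rewrite unvec_lin; exact: Ilin.
have [|u uA uT] := @separate K _ A T.
  by apply/negP=> /AP; rewrite vecK.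
by exists u => // z Iz; apply: uA; apply/AP; rewrite vecK.
Qed.

Lemma span_of_annihilators K r (p : 'I_r -> gtensor K) (f : gtensor K) :
  (forall T, (forall i, dot (p i) T = 0) -> dot f T = 0) ->
  exists c : 'I_r -> F, f = \sum_i c i *: p i.
Proof.
move=> h; pose A : 'M[F]_(r, #|{ffun K -> 'I_n}|) := \matrix_i vec (p i).
have [/submxP[D fD]|/separate[u uA uf]] := boolP (vec f <= A)%MS.
  exists (D 0); rewrite -[LHS]vecK fD; apply/ffunP=> w; rewrite ffunE mxE sum_ffunE.
  by apply: eq_bigr => i _; rewrite !ffunE !mxE enum_rankK.
case/eqP: uf; rewrite dotC; apply: h => i; rewrite dotC; apply: uA.
by rewrite -(rowK (fun i => vec (p i)) i) row_sub.
Qed.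

End Duality.

(** * The ideal of a rank one tensor in degree lambda *)

Section IdealOfPoint.
Context {F : fieldType} {n : nat}.
Hypothesis HF : has_pchar0 F.
Local Notation gtensor K := {ffun {ffun K%type -> 'I_n} -> F^o}.
Variable lam : seq nat.
Hypotheses (plam : is_part lam) (len : (size lam < n)%N).
Local Notation d := (sumn lam).
Local Notation R := (@symR F n lam).
Local Notation C := (@antiC F n lam).
Variable p : gtensor 'I_d.
Hypothesis p1 : lam_rank1 lam p.
Local Notation I mu := (@Ideal F n lam p mu).

Lemma Ideal_polar mu (x : tensor (sumn mu)) : I mu x -> polar p x.
Proof.
apply; [exact: polar_graded| |exact: polar_mult_closed].
by move=> v fv pv; apply: (polar_contains_gens HF plam len fv pv).
Qed.

Lemma Ideal_graded : graded_subspace (@Ideal F n lam p).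
Proof.
move=> mu vmu; split=> [J|t x y Ix Iy J|x /Ideal_polar[]//] gJ cJ mJ.
  by have [] := gJ mu vmu.
by have [_ h _] := gJ mu vmu; apply: h; [exact: Ix|exact: Iy].
Qed.

Lemma Ideal_mult_closed : mult_closed (@Ideal F n lam p).
Proof.
move=> a b c va vb vc LR M MM x y Ix Sy J gJ cJ mJ.
by apply: (mJ a b c va vb vc LR M MM) => //; exact: Ix.
Qed.

Lemma Ideal_contains_gens v : row_free v -> p = rank1 lam v ->
  contains_gens lam v (@Ideal F n lam p).
Proof.
move=> fv pv c cs h m al Wal J gJ cJ mJ.
exact: (cJ v fv pv c cs al Wal).
Qed.

(** When both shapes are lambda every box is contracted, so any word of free indices shows the full
    coordinate pairing, up to the inverse of the product of factorials. *)
Lemma apolar_self (f g : gtensor 'I_d) : apolar lam lam f g = 0 -> dot f g = 0.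
Proof.
have n0 : (0 < n)%N by exact: leq_ltn_trans len.
move/ffunP/(_ [ffun=> Ordinal n0]); rewrite ffunE [RHS]ffunE => /eqP.
have c0 : \prod_(c <- Defs.conj lam) (c`!)%:R != 0 :> F.
  rewrite prodf_seq_neq0; apply/allP=> c _ /=.
  by rewrite (proj1 (pcharf0P F) HF) -lt0n fact_gt0.
rewrite mulf_eq0 invr_eq0 (negbTE c0) /= => /eqP <-.
apply: eq_bigr => j _; rewrite mulrC; congr (_ * f _); apply/ffunP=> k.
by rewrite [RHS]ffunE /= rowof_bound // offset_colof // valK.
Qed.

(** Allows an arbitrary test tensor to be replaced by one in the Schur module, the pairing changing
    only by a nonzero scalar. *)
Lemma dot_young (f T : gtensor 'I_d) : SchurMod lam f ->
  dot f (C (R (C T))) = ncols lam * kappa plam (ltnW len) * dot f T.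
Proof.
move=> Sf; have Cf : C f = ncols lam *: f by case: Sf => U ->; rewrite antiCK.
rewrite -dot_antiC -dot_symR -dot_antiC Cf !linearZ /= (young_kappa HF plam (ltnW len)) //.
by rewrite scalerA dotC linearZ dotC.
Qed.

Lemma Ideal_top (z : gtensor 'I_d) : SchurMod lam z -> dot p z = 0 -> I lam z.
Proof.
move=> Sz pz; apply: NNPP => nz; have vl : @validp n lam by rewrite /validp plam.
have [I0 Ilin IS] := Ideal_graded vl.
have [u uI] := separate_subspace I0 Ilin nz.
have [v [fv pv]] := p1.
have [g ug vg] := frame_extend len fv.
(* The inclusion already proved: subtracting a multiple of [p] from [u] keeps it zero on the
   ideal. *)
have pI x : I lam x -> dot p x = 0.
  move=> Ix; apply: apolar_self; apply: polar_perp => //; exact: Ideal_polar.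
(* The two changes of basis cancel, leaving the pairing of the highest weight vector with itself,
   which is the order of the column group. *)
have pf : frame_form p g 1%:M != 0.
  rewrite /frame_form pv vg mulmx1 !tact_rank1 // dot_tact tactM -trmx_mul mulmxV // trmx1 tact1.
  rewrite -/(hw_vector lam) {1}(hw_vectorE plam (ltnW len)) dot_antiC dotC dot_word.
  rewrite (hw_vectorE plam (ltnW len)) antiCK -hw_vectorE ffunE hw_vector_hw.
  by rewrite /GRing.scale /= mulr1 ncols_neq0.
pose c := frame_form u g 1%:M / frame_form p g 1%:M.
pose u' := u - c *: p.
have u'E x : dot u' x = dot u x - c * dot p x.
  by rewrite dotC (linearB (dot x)) /= (linearZ_LR (dot x)) /= ![dot x _]dotC.
have u'I x : I lam x -> dot u' x = 0 by move=> Ix; rewrite u'E uI // pI // mulr0 subr0.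
have f1 : frame_form u' g 1%:M = 0 by rewrite /frame_form u'E /c divfK ?subrr.
have := annihilator_eq0 HF plam len (Ideal_contains_gens fv pv) Ideal_mult_closed u'I ug vg f1 Sz.
by rewrite u'E pz mulr0 subr0 => ->; rewrite eqxx.
Qed.

End IdealOfPoint.

Lemma apolar_sum (F : fieldType) (n : nat) (lam mu : seq nat) (r : nat) (c : 'I_r -> F)
    (p : 'I_r -> @tensor F n (sumn lam)) (g : @tensor F n (sumn mu)) :
  (forall i, apolar lam mu (p i) g = 0) -> apolar lam mu (\sum_i c i *: p i) g = 0.
Proof.
move=> h; apply/ffunP=> w; rewrite ffunE [RHS]ffunE.
have h' i := congr1 (fun T : {ffun {ffun 'I_(sumn lam) -> 'I_n} -> F^o} => T w) (h i).
transitivity (\sum_i c i * (apolar lam mu (p i) g : {ffun {ffun 'I_(sumn lam) -> 'I_n} -> F^o}) w).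
  under [RHS]eq_bigr do rewrite ffunE mulrCA.
  rewrite -mulr_sumr; congr (_ * _).
  under [RHS]eq_bigr do rewrite mulr_sumr.
  rewrite [RHS]exchange_big /=; apply: eq_bigr => j _.
  rewrite sum_ffunE mulr_sumr; apply: eq_bigr => i _.
  by rewrite ffunE /GRing.scale /= mulrCA.
by apply: big1 => i _; rewrite h' ffunE mulr0.
Qed.

Unset Implicit Arguments.

Theorem theorem4p3 (F : closedFieldType) (HF : has_pchar0 F) (n : nat)
  (lam : seq nat) (Hlam : is_part lam) (Hlen : (size lam < n)%N)
  (f : @tensor F n (sumn lam)) (Hf : SchurMod lam f)
  (r : nat) (Hr : (0 < r)%N) (p : 'I_r -> @tensor F n (sumn lam))
  (Hp : forall i, lam_rank1 lam (p i)) :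
  (exists c : 'I_r -> F, f = \sum_(i < r) c i *: p i) <->
  (forall mu : seq nat, @validp n mu -> forall g : @tensor F n (sumn mu),
     (forall i, Ideal lam (p i) mu g) -> in_perp lam f mu g).
Proof.
split=> [[c ->] mu vmu g Ig|perp].
  have polg i : polar (p i) g by apply: (Ideal_polar HF Hlam Hlen); exact: Ig.
  (* Some point is needed here: membership of [g] in its Schur module is read off from the ideal of
     one of them. *)
  split=> [|sub]; first exact: (polg (Ordinal Hr)).1.
  by apply: apolar_sum => i; apply: polar_perp => //; case/andP: vmu.
have Sp i : SchurMod lam (p i).
  by have [v [_ ->]] := Hp i; apply: SchurMod_rank1.
apply: span_of_annihilators => T pT.
(* Degree lambda is enough: the symmetrized test tensor is still orthogonal to every [p i], hence
   lies in each ideal, and its pairing with [f] is that of [T] up to a nonzero scalar. *)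
pose g : {ffun {ffun 'I_(sumn lam) -> 'I_n} -> F^o} := antiC lam (symR lam (antiC lam T)).
have Sg : SchurMod lam g by exists (antiC lam T).
have vl : @validp n lam by rewrite /validp Hlam.
have [i|_ fg] := perp lam vl g.
  by apply: Ideal_top => //; rewrite /g (dot_young HF Hlam Hlen) // pT mulr0.
have /(apolar_self HF Hlam Hlen)/eqP : apolar lam lam f g = 0 by apply: fg; split.
rewrite /g (dot_young HF Hlam Hlen) // !mulf_eq0 (negbTE (ncols_neq0 _ HF)).
by rewrite (negbTE (kappa_neq0 HF _ _)) => /eqP.
Qed.
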